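(* Let $X$ be a finite connected simplicial complex of dimension at least $1$, let $n\ge2$, and let $x\in X$ be a point of valency $k$, with $\operatorname{lk}_X(x)=\coprod_{j=1}^kL^j$ the decomposition of its link into connected components. Put $X_x=X\setminus\{x\}$. Then $F_n(X)$ is homotopy equivalent to (the total space of) the graph of spaces $\mathcal G_n(X,x)$, over an underlying graph $\mathsf G_n(X,x)$ (the *distribution graph* ), described as follows: (i) the vertex spaces are the connected components of $F_n(X_x)$, together with the connected components of $n$ copies $F^i_{n-1}(X_x)$, $i=1,\dots,n$, of $F_{n-1}(X_x)$; (ii) the edge spaces are the connected components of $F^i_{n-1}(X_x)\times L^j$ for $1\le i\le n$, $1\le j\le k$; each such edge space $C\times L^j$, with $C\in\pi_0(F^i_{n-1}(X_x))$, is attached by the two maps $$F_n(X_x)\xleftarrow{\ \phi_{ij}\ }C\times L^j\xrightarrow{\ \mathrm{Proj}_1\ }F^i_{n-1}(X_x),$$ where $\mathrm{Proj}_1$ is the projection onto the first factor and $\phi_{ij}$ is induced (up to homotopy) by inserting each point of $L^j$ as the $i$-th coordinate. In particular the numbers of vertices and edges of $\mathcal G_n(X,x)$ are $$|\pi_0(F_n(X_x))|+n\cdot|\pi_0(F_{n-1}(X_x))|\qquad\text{and}\qquad nk\cdot|\pi_0(F_{n-1}(X_x))|.$$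
   Context: $F_m(Y)=\{(y_1,\dots,y_m)\in Y^m: y_a\ne y_b\text{ for }a\ne b\}$. The link and valency of a point $x$ are taken after subdividing $X$ so that $x$ is a vertex; the valency is the number of connected components of the link. Points of $F^i_{n-1}(X_x)$ are thought of as configurations $(x_1,\dots,\hat x_i,\dots,x_n)$ in $X_x$ with the $i$-th strand resting at $x$. For $\phi_{ij}$: let $U_x\cong \operatorname{lk}_X(x)\times[0,1)/\operatorname{lk}_X(x)\times\{0\}$ be the open star of $x$; using the homotopy equivalence $F_{n-1}(X_x)\simeq F_{n-1}(X\setminus\overline{U_x})$ (pushing the points out of the star), $\phi_{ij}$ sends a configuration of $n-1$ points outside the star and a point $p\in L^j$ to the $n$-point configuration obtained by adding, as $i$-th coordinate, the point $(p,3/4)\in L^j\times\{3/4\}\subset U_x\setminus\{x\}$. The total space of a graph of spaces is the union of the vertex spaces and of cylinders (edge space)$\times[0,1]$ glued by the attaching maps; it may be disconnected. *)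

(* Defs.v *)
From HB Require Import structures.
From mathcomp Require Import all_boot all_order all_algebra generic_quotient.
From mathcomp Require Import all_classical all_reals all_analysis.
From Stdlib Require Export Relation_Operators.

Set Implicit Arguments.
Unset Strict Implicit.
Unset Printing Implicit Defensive.
Import Order.TTheory GRing.Theory Num.Theory.
Import numFieldNormedType.Exports.
Local Open Scope classical_set_scope.
Local Open Scope ring_scope.

(* A set [A : set T] used as a type carries the subspace topology. *)

Section homotopy.
Context {R : realType}.

Definition unit_interval : topologicalType := `[0 : R, 1]%classic.

Lemma unit_interval0_subproof : (0 : R) \in `[0 : R, 1]%classic.
Proof. by apply/mem_set; rewrite /= in_itv /= lexx ler01. Qed.

Lemma unit_interval1_subproof : (1 : R) \in `[0 : R, 1]%classic.
Proof. by apply/mem_set; rewrite /= in_itv /= lexx ler01. Qed.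

Definition unit0 : unit_interval := SigSub unit_interval0_subproof.
Definition unit1 : unit_interval := SigSub unit_interval1_subproof.

Definition homotopic (S T : topologicalType) (f g : S -> T) : Prop :=
  exists H : S * unit_interval -> T,
    [/\ continuous H, forall s, H (s, unit0) = f s
      & forall s, H (s, unit1) = g s].

Definition homotopy_inverse (S T : topologicalType) (f : S -> T) (g : T -> S) :
    Prop :=
  [/\ continuous f, continuous g, homotopic (g \o f) id
    & homotopic (f \o g) id].

Definition homotopy_equivalent (S T : topologicalType) : Prop :=
  exists (f : S -> T) (g : T -> S), homotopy_inverse f g.

End homotopy.

Arguments unit_interval : clear implicits.
Arguments homotopic R {S T} f g.
Arguments homotopy_inverse R {S T} f g.
Arguments homotopy_equivalent R S T : clear implicits.

Definition components (T : topologicalType) (A : set T) : set (set T) :=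
  connected_component A @` A.

Definition pi0 (T : topologicalType) : set (set T) := components [set: T].

Arguments pi0 : clear implicits.

Section pi0_map.
Context {S T : topologicalType}.

Definition pi0_point (C : pi0 S) : S := sval (cid2 (set_valP C)).

Lemma pi0_of_subproof (t : T) : connected_component [set: T] t \in pi0 T.
Proof. by apply/mem_set; exists t. Qed.

Definition pi0_of (t : T) : pi0 T := SigSub (pi0_of_subproof t).

Definition pi0_map (f : S -> T) (C : pi0 S) : pi0 T := pi0_of (f (pi0_point C)).

Lemma restrict_subproof (f : S -> T) (C : pi0 S) (s : val C) :
  continuous f -> f (val s) \in val (pi0_map f C).
Proof.
move=> fC; apply/mem_set; rewrite /= /pi0_point.
case: cid2 => /= s0 _ s0C.
have s0E : connected_component [set: S] s0 = val C by [].
apply: (@connected_component_max _ _ (f @` val C)).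
- by exists s0 => //; rewrite -s0E; exact: connected_component_refl.
- exact: subsetT.
- apply: connected_continuous_connected; last exact: continuous_subspaceT.
  by rewrite -s0E; exact: component_connected.
- by exists (val s) => //; exact: set_valP.
Qed.

Definition restrict (f : S -> T) (fC : continuous f) (C : pi0 S) :
    val C -> val (pi0_map f C) :=
  fun s => SigSub (restrict_subproof s fC).

Lemma restrict_continuous (f : S -> T) (fC : continuous f) (C : pi0 S) :
  continuous (@restrict f fC C).
Proof.
apply/continuousP => _ [A oA <-].
suff -> : restrict fC (C := C) @^-1` (set_val @^-1` A) =
    (f \o set_val) @^-1` A by
  apply: open_comp => // s _; apply: continuous_comp;
  [exact: initial_continuous | exact: fC].
by [].
Qed.

End pi0_map.

Record graph_of_spaces := GraphOfSpaces {
  gs_vertex : choiceType;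
  gs_edge : choiceType;
  gs_source : gs_edge -> gs_vertex;
  gs_target : gs_edge -> gs_vertex;
  gs_vertex_space : gs_vertex -> topologicalType;
  gs_edge_space : gs_edge -> topologicalType;
  gs_attach0 : forall e, gs_edge_space e -> gs_vertex_space (gs_source e);
  gs_attach1 : forall e, gs_edge_space e -> gs_vertex_space (gs_target e);
  gs_attach0_continuous : forall e, continuous (@gs_attach0 e);
  gs_attach1_continuous : forall e, continuous (@gs_attach1 e) }.

Section total_space.
Local Open Scope quotient_scope.
Variables (R : realType) (G : graph_of_spaces).

Definition piece (z : (gs_vertex G + gs_edge G)%type) : topologicalType :=
  match z with
  | inl v => gs_vertex_space v
  | inr e => (gs_edge_space e * unit_interval R)%type
  end.

Definition pieces : topologicalType := {z & piece z}.

Inductive glue : pieces -> pieces -> Prop :=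
| Glue0 e (y : gs_edge_space e) :
    glue (existT piece (inr e) (y, unit0))
         (existT piece (inl (gs_source e)) (gs_attach0 y))
| Glue1 e (y : gs_edge_space e) :
    glue (existT piece (inr e) (y, unit1))
         (existT piece (inl (gs_target e)) (gs_attach1 y)).

Definition glue_eq (a b : pieces) : bool :=
  `[< clos_refl_sym_trans pieces glue a b >].

Lemma glue_eq_refl : reflexive glue_eq.
Proof. by move=> a; apply/asboolP; exact: rst_refl. Qed.

Lemma glue_eq_sym : symmetric glue_eq.
Proof.
by move=> a b; apply/idP/idP => /asboolP ab; apply/asboolP; exact: rst_sym.
Qed.

Lemma glue_eq_trans : transitive glue_eq.
Proof.
move=> b a c /asboolP ab /asboolP bc; apply/asboolP.
exact: rst_trans ab bc.
Qed.

Definition glue_equiv := EquivRel _ glue_eq_refl glue_eq_sym glue_eq_trans.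

Definition total_space : topologicalType :=
  quotient_topology {eq_quot glue_equiv}.

End total_space.

(* A, B and L j stand for F_n(X_x), F_{n-1}(X_x) and L^j. Since a continuous map
   sends a component into a component, [phi i j] and the first projection
   restrict to attaching maps on each component of B * L j. *)

Section distribution_graph.
Context {n k : nat} {A B : topologicalType} {L : 'I_k -> topologicalType}.
Variable phi : forall (i : 'I_n) (j : 'I_k), B * L j -> A.
Hypothesis phiC : forall i j, continuous (@phi i j).

Definition dg_vertex : choiceType := (pi0 A + 'I_n * pi0 B)%type.

Definition dg_edge : choiceType :=
  {ij : 'I_n * 'I_k & pi0 (B * L ij.2)%type}.

Definition dg_vertex_space (v : dg_vertex) : topologicalType :=
  match v with
  | inl C => set_type (val C)
  | inr (_, C) => set_type (val C)
  end.

Definition dg_edge_space (e : dg_edge) : topologicalType :=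
  set_type (val (projT2 e)).

Definition dg_source (e : dg_edge) : dg_vertex :=
  inl (pi0_map (@phi (projT1 e).1 (projT1 e).2) (projT2 e)).

Definition dg_target (e : dg_edge) : dg_vertex :=
  inr ((projT1 e).1, pi0_map fst (projT2 e)).

Lemma proj1_continuous (j : 'I_k) : continuous (fst : B * L j -> B).
Proof. by move=> z; exact: cvg_fst. Qed.

Definition distribution_graph : graph_of_spaces :=
  @GraphOfSpaces dg_vertex dg_edge dg_source dg_target
    dg_vertex_space dg_edge_space
    (fun e => restrict (phiC (i := (projT1 e).1) (j := (projT1 e).2))
                (C := projT2 e))
    (fun e => restrict (@proj1_continuous (projT1 e).2) (C := projT2 e))
    (fun e => @restrict_continuous _ _ _ _ (projT2 e))
    (fun e => @restrict_continuous _ _ _ _ (projT2 e)).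

End distribution_graph.

Definition simplicial_complex (V : finType) (K : {set {set V}}) : Prop :=
  (finset.set0 \notin K) /\
  (forall s t : {set V},
     s \in K -> t \subset s -> t != finset.set0 -> t \in K).

Section simplicial.
Context {R : realType}.

Definition supp d (y : 'rV[R]_d) : {set 'I_d} := finset (fun v => y 0 v != 0).

(* Barycentric coordinates: vertex v is the v-th standard basis vector. *)
Definition realization d (K : {set {set 'I_d}}) : set 'rV[R]_d :=
  [set y : 'rV[R]_d | [/\ forall v, 0 <= y 0 v, \sum_v y 0 v = 1 & supp y \in K]].

(* A subdivision K' of K: row w of P is the point of |K| at which the vertex w
   of K' sits, and the linear extension [y |-> y *m P] identifies |K'| with
   |K|, every simplex of K' lying in a simplex of K. *)
Definition subdivision d (K : {set {set 'I_d}}) m (K' : {set {set 'I_m}})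
    (P : 'M[R]_(m, d)) : Prop :=
  [/\ simplicial_complex K',
      set_bij (realization K') (realization K) (fun y => y *m P)
    & forall s, s \in K' ->
        exists2 t, t \in K & forall w, w \in s -> supp (row w P) \subset t].

Definition link m (K' : {set {set 'I_m}}) (w : 'I_m) : {set {set 'I_m}} :=
  finset (fun t : {set 'I_m} =>
    [&& t \in K', w \notin t & (w |: t)%SET \in K']).

(* The link of the vertex w of the subdivision (K', P), as a subset of |K|. *)
Definition link_space m d (K' : {set {set 'I_m}}) (P : 'M[R]_(m, d))
    (w : 'I_m) : set 'rV[R]_d :=
  [set y *m P | y in realization (link K' w)].

(* The point with cone coordinates (p, s), p in the link of x and 0 <= s <= 1,
   in the star of x shrunk by the factor e; e = 1 gives the whole star. Points
   can be pushed out of the closed star only if there is room beyond it, which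
   e < 1 guarantees: when X is an edge with endpoint x, the complement of the
   unshrunk closed star is empty. *)
Definition cone_point d (x : 'rV[R]_d) (e : R) (p : 'rV[R]_d) (s : R) :
    'rV[R]_d :=
  (1 - e * s) *: x + (e * s) *: p.

Definition open_star d (x : 'rV[R]_d) (Lk : set 'rV[R]_d) (e : R) :
    set 'rV[R]_d :=
  x |` [set cone_point x e ps.1 ps.2 | ps in Lk `*` `[0, 1[%classic].

(* A configuration of m points is the m x d matrix whose rows are the points;
   the topology of matrices is the product topology. *)

Definition conf m d (Y : set 'rV[R]_d) : set 'M[R]_(m, d) :=
  [set c | (forall a, Y (row a c)) /\ injective (fun a => row a c)].

Definition insert_point n d (i : 'I_n) (p : 'rV[R]_d) (c : 'M[R]_(n.-1, d)) :
    'M[R]_(n, d) :=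
  \matrix_(a < n) (if unlift i a is Some b then row b c else p).

Lemma conf_subset m d (Y Z : set 'rV[R]_d) :
  Y `<=` Z -> @conf m d Y `<=` @conf m d Z.
Proof. by move=> YZ c [Yc injc]; split => // a; exact/YZ/Yc. Qed.

Lemma outside_star_subset d (X Lk : set 'rV[R]_d) (x : 'rV[R]_d) (e : R) :
  X `\` closure (open_star x Lk e) `<=` X `\ x.
Proof.
move=> y [Xy yU]; split=> // yx; apply: yU; apply: subset_closure; left.
exact: yx.
Qed.

Definition conf_outside_incl m d (X Lk : set 'rV[R]_d) (x : 'rV[R]_d) (e : R) :
    @conf m d (X `\` closure (open_star x Lk e)) -> @conf m d (X `\ x) :=
  subfun (conf_subset (@outside_star_subset d X Lk x e)).

End simplicial.

Arguments conf {R} m {d} Y.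
Arguments conf_outside_incl {R} m {d} X Lk x e.

(* Main.v *)
(* Let h be the distance to x in cone coordinates of the star of x, cut off at 1
   outside the star. A configuration in F_n(X) either has all h(x_i) > 0, so lies in
   A = F_n(X_x), or has exactly one point at x; near the latter configurations the
   point x_i with h(x_i) small slides along a ray of the star, and the position on
   that ray, its link coordinate and the other n - 1 points are coordinates. So
   F_n(X) is the double mapping cylinder of A <- B * L^j -> B, B = F_{n-1}(X_x), for
   the map inserting a point at radius half the product of the h(x_l), up to the
   collar of configurations in A inside that radius, which is folded onto the edges.
   The total space of the distribution graph is the same double mapping cylinder
   for phi, because components are open: there are finitely many of them, as a
   configuration space in X_x is a finite union of convex sign cells. The two
   insertions are homotopic, using only that r followed by the inclusion is
   homotopic to the identity, and double mapping cylinders are homotopy invariant. *)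

Require Import Defs.
From mathcomp Require Import all_boot all_order all_algebra.
From mathcomp Require Import generic_quotient.
From mathcomp Require Import all_classical all_reals all_analysis.
From mathcomp Require Import ring lra.

Set Implicit Arguments.
Unset Strict Implicit.
Unset Printing Implicit Defensive.
Import Order.TTheory GRing.Theory Num.Theory.
Import numFieldNormedType.Exports.
Local Open Scope classical_set_scope.
Local Open Scope ring_scope.
Local Open Scope card_scope.

(** * Continuity *)

(** The collar of [A] inside the seam occurs twice in the cylinder [T]: in the vertex space [A] and
    again as the open edges. Radial insertion maps [T] to [F_n(X)] and identifies the two copies.
    This map has a strict section, which takes the edge copy; reflecting the collar across the seam
    deforms the identity of [T] into the map followed by the section. The factor one half puts the
    seam in the middle of the range of radii where insertion is a chart, so both sides of the seam
    are covered by one chart. The delicate point is continuity of the section at a configuration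
    with a point at [x]. The link coordinate is undefined there, and a neighbourhood in the quotient
    topology might become arbitrarily thin as the direction varies; compactness of the link excludes
    this. Homotopies out of [T] require that [T] times the interval still has the universal property
    of the gluing. This is therefore built into the notion of cylinder, and for total spaces it
    comes from the exponential law for the interval. *)

Section continuity.
Context {S T U : topologicalType}.

Lemma cts_id : continuous (fun s : S => s).
Proof. by move=> s; exact: cvg_id. Qed.

Lemma cts_cst (t : T) : continuous (fun _ : S => t).
Proof. by move=> s; exact: cvg_cst. Qed.

Lemma cts_comp (g : T -> U) (f : S -> T) :
  continuous g -> continuous f -> continuous (fun s => g (f s)).
Proof. by move=> cg cf s; apply: continuous_comp; [exact: cf|exact: cg]. Qed.

Lemma cts_fst (f : S -> T * U) : continuous f -> continuous (fun s => (f s).1).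
Proof. by move=> cf s; apply: (continuous_comp (cf s)); exact: cvg_fst. Qed.

Lemma cts_snd (f : S -> T * U) : continuous f -> continuous (fun s => (f s).2).
Proof. by move=> cf s; apply: (continuous_comp (cf s)); exact: cvg_snd. Qed.

Lemma cts_fst_proj : continuous (@fst S T).
Proof. by move=> s; exact: cvg_fst. Qed.

Lemma cts_snd_proj : continuous (@snd S T).
Proof. by move=> s; exact: cvg_snd. Qed.

Lemma cts_val_incl (A : set T) : continuous (val : A -> T).
Proof. exact: initial_continuous. Qed.

Lemma cts_pair (f : S -> T) (g : S -> U) :
  continuous f -> continuous g -> continuous (fun s => (f s, g s)).
Proof. by move=> cf cg s; apply: cvg_pair; [exact: cf|exact: cg]. Qed.

Lemma cts_val (A : set T) (f : S -> A) :
  continuous f -> continuous (fun s => val (f s)).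
Proof.
move=> cf s; apply: (continuous_comp (cf s)); exact: initial_continuous.
Qed.

Lemma cts_sub (A : set T) (f : S -> A) :
  continuous (fun s => val (f s)) -> continuous f.
Proof.
move=> /continuousP cf; apply/continuousP => _ [B oB <-]; exact: (cf B).
Qed.

Lemma cts_at_open_pt (f : S -> T) (D : set S) (o : D) :
  open D -> {for o, continuous (fun o : D => f (val o))} ->
  {for val o, continuous f}.
Proof.
move=> oD cf W /cf [_ [[E oE <-] /= Eo sub]].
apply: (@filterS _ _ _ (E `&` D)) => [s [Es Ds]|].
  exact: (sub (SigSub (mem_set Ds))).
apply: open_nbhs_nbhs; split; first exact: openI.
by split => //; exact: set_valP.
Qed.

Lemma cts_at_open (f : S -> T) (D : set S) : open D ->
  continuous (fun o : D => f (val o)) -> forall s, D s -> {for s, continuous f}.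
Proof.
move=> oD cf s Ds.
exact: (@cts_at_open_pt f D (SigSub (mem_set Ds)) oD (cf _)).
Qed.

Lemma cts_pairl (t : T) : continuous (pair t : U -> T * U).
Proof. by move=> u; apply: cvg_pair => /=; [exact: cvg_cst|exact: cvg_id]. Qed.

End continuity.

Lemma cts_eq (S T : topologicalType) (f g : S -> T) :
  f =1 g -> continuous f -> continuous g.
Proof. by move=> /funext ->. Qed.

Section real_continuity.
Context {R : realType} {S : topologicalType}.
Implicit Types f g : S -> R.

Lemma ctsD f g : continuous f -> continuous g -> continuous (fun s => f s + g s).
Proof. by move=> cf cg s; apply: cvgD; [exact: cf|exact: cg]. Qed.

Lemma ctsN f : continuous f -> continuous (fun s => - f s).
Proof. by move=> cf s; apply: cvgN; exact: cf. Qed.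

Lemma ctsM f g : continuous f -> continuous g -> continuous (fun s => f s * g s).
Proof. by move=> cf cg s; apply: cvgM; [exact: cf|exact: cg]. Qed.

Lemma ctsV f : (forall s, f s != 0) -> continuous f ->
  continuous (fun s => (f s)^-1).
Proof. by move=> f0 cf s; apply: cvgV => //; exact: cf. Qed.

Lemma cts_min f g : continuous f -> continuous g ->
  continuous (fun s => Num.min (f s) (g s)).
Proof. by move=> cf cg s; apply: continuous_min; [exact: cf|exact: cg]. Qed.

Lemma cts_max f g : continuous f -> continuous g ->
  continuous (fun s => Num.max (f s) (g s)).
Proof. by move=> cf cg s; apply: continuous_max; [exact: cf|exact: cg]. Qed.

Lemma cts_prod (I : Type) (r : seq I) (f : I -> S -> R) :
  (forall i, continuous (f i)) -> continuous (fun s => \prod_(i <- r) f i s).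
Proof.
move=> cf; elim: r => [|i r IH].
  by under eq_fun do rewrite big_nil; exact: cts_cst.
by under eq_fun do rewrite big_cons; exact: ctsM.
Qed.

Lemma cts_coord m n (F : S -> 'M[R]_(m, n)) i j :
  continuous F -> continuous (fun s => F s i j).
Proof.
move=> cF s.
apply: (@continuous_comp _ _ _ F (fun M : 'M[R]_(m, n) => M i j) s (cF s)).
exact: coord_continuous.
Qed.

Lemma cts_mx m n (F : S -> 'M[R]_(m, n)) :
  (forall i j, continuous (fun s => F s i j)) -> continuous F.
Proof.
move=> cF s A [P nP sPA].
have : \forall s' \near s, forall ij : 'I_m * 'I_n, P ij.1 ij.2 (F s' ij.1 ij.2).
  apply: filter_forall => -[i j] /=; exact: (cF i j s _ (nP i j)).
by apply: filterS => s' Ps'; apply: sPA => i j; exact: (Ps' (i, j)).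
Qed.

Lemma open_lt_cts f g : continuous f -> continuous g -> open [set s | f s < g s].
Proof.
move=> cf cg; rewrite (_ : [set _ | _] = (fun s => g s - f s) @^-1` [set r | 0 < r]).
  by apply: open_comp; [move=> s _; exact/ctsD/ctsN|exact: open_gt].
by apply/seteqP; split => s /=; rewrite subr_gt0.
Qed.

(** Both branches are continuous on all of [S], not just on their own half. Time parameters are
    therefore wrapped in [clamp], whose values beyond the relevant half do not matter. *)
Lemma paste (T : topologicalType) (u : S -> R) (f g : S -> T) :
  continuous u -> continuous f -> continuous g ->
  (forall s, u s = 0 -> f s = g s) ->
  continuous (fun s => if u s <= 0 then f s else g s).
Proof.
move=> cu cf cg fg s; have [u0|u0|u0] := ltgtP (u s) 0.
- rewrite /continuous_at/= ltW//; apply: cvg_trans (cf s).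
  apply: near_eq_cvg; have : \forall t \near s, u t < 0.
    exact: (cu s _ (open_nbhs_nbhs (conj (open_lt (y:=0)) u0))).
  by apply: filterS => t /ltW ->.
- rewrite /continuous_at/= leNgt u0/=; apply: cvg_trans (cg s).
  apply: near_eq_cvg; have : \forall t \near s, 0 < u t.
    exact: (cu s _ (open_nbhs_nbhs (conj (open_gt (y:=0)) u0))).
  by apply: filterS => t; rewrite leNgt => ->.
- move=> V; rewrite u0 lexx => Vf.
  have Vg : nbhs (g s) V by rewrite -fg.
  have Vfs : nbhs s (f @^-1` V) by exact: (cf s).
  have Vgs : nbhs s (g @^-1` V) by exact: (cg s).
  by apply: filterS (filterI Vfs Vgs) => t [? ?] /=; case: ifP.
Qed.

End real_continuity.

Section clamp.
Context {R : realType}.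

Lemma clamp_subproof (t : R) : Num.max 0 (Num.min 1 t) \in `[0 : R, 1]%classic.
Proof.
apply/mem_set; rewrite /= in_itv /= le_max lexx /= ge_max ler01 /=.
by rewrite ge_min lexx.
Qed.

Definition clamp (t : R) : unit_interval R := SigSub (clamp_subproof t).

Lemma clamp_continuous : continuous clamp.
Proof.
apply: cts_sub; apply: cts_max; first exact: cts_cst.
by apply: cts_min; [exact: cts_cst|exact: cts_id].
Qed.

Lemma val_unit_ge0 (t : unit_interval R) : 0 <= val t.
Proof. by have := set_valP t; rewrite /= in_itv/= => /andP[]. Qed.

Lemma val_unit_le1 (t : unit_interval R) : val t <= 1.
Proof. by have := set_valP t; rewrite /= in_itv/= => /andP[]. Qed.

Lemma val_clamp t : 0 <= t -> t <= 1 -> val (clamp t) = t.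
Proof. by move=> t0 t1 /=; rewrite min_r// max_r. Qed.

Lemma clampK (t : unit_interval R) : clamp (val t) = t.
Proof. by apply: val_inj; rewrite val_clamp// ?val_unit_ge0 ?val_unit_le1. Qed.

Lemma clamp_le0 t : t <= 0 -> clamp t = unit0.
Proof.
move=> t0; apply: val_inj => /=; rewrite min_r ?max_l//.
by rewrite (le_trans t0).
Qed.

Lemma clamp_ge1 t : 1 <= t -> clamp t = unit1.
Proof. by move=> t1; apply: val_inj => /=; rewrite min_l// max_r. Qed.

Lemma clamp0 : clamp 0 = unit0. Proof. exact: clamp_le0. Qed.
Lemma clamp1 : clamp 1 = unit1. Proof. exact: clamp_ge1. Qed.

End clamp.

Lemma cts_clamp {R : realType} (S : topologicalType) (f : S -> R) :
  continuous f -> continuous (fun s => clamp (f s)).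
Proof. exact/cts_comp/clamp_continuous. Qed.

Ltac cts := lazymatch goal with
  | |- forall x, @continuous_at _ _ x ?f => lazymatch f with
    | (fun _ => ?c) => exact: cts_cst
    | (fun s => s) => exact: cts_id
    | id => exact: cts_id
    | fst => exact: cts_fst_proj
    | snd => exact: cts_snd_proj
    | @isSub.val_subdef _ _ _ _ => exact: cts_val_incl
    | @proj1_sig _ _ => exact: cts_val_incl
    | pair ?c => exact: cts_pairl
    | (fun s => (@?g s).1) => apply: (@cts_fst _ _ _ g); cts
    | (fun s => (@?g s).2) => apply: (@cts_snd _ _ _ g); cts
    | (fun s => @isSub.val_subdef _ _ _ _ (@?g s)) =>
        apply: (@cts_val _ _ _ g); cts
    | (fun s => @proj1_sig _ _ (@?g s)) => apply: (@cts_val _ _ _ g); cts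
    | (fun s => (@?g s, @?g' s)) => apply: (@cts_pair _ _ _ g g'); cts
    | (fun s => clamp (@?g s)) => apply: (@cts_clamp _ _ g); cts
    | (fun s => (@?g s + @?g' s)%R) => apply: (@ctsD _ _ g g'); cts
    | (fun s => (@?g s * @?g' s)%R) => apply: (@ctsM _ _ g g'); cts
    | (fun s => (- @?g s)%R) => apply: (@ctsN _ _ g); cts
    | (fun s => Num.min (@?g s) (@?g' s)) => apply: (@cts_min _ _ g g'); cts
    | (fun s => Num.max (@?g s) (@?g' s)) => apply: (@cts_max _ _ g g'); cts
    | _ => try assumption
    end
  | _ => idtac
  end.

(** * Homotopies and double mapping cylinders *)

Section homotopy_theory.
Context {R : realType}.
Local Notation I := (unit_interval R).

Lemma val_unit0 : val (unit0 : I) = 0. Proof. by []. Qed.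
Lemma val_unit1 : val (unit1 : I) = 1. Proof. by []. Qed.

Lemma homotopic_trans (S T : topologicalType) (f g h : S -> T) :
  homotopic R f g -> homotopic R g h -> homotopic R f h.
Proof.
move=> [F [cF F0 F1]] [G [cG G0 G1]].
exists (fun z => if val z.2 * 2 - 1 <= 0 then F (z.1, clamp (val z.2 * 2))
                 else G (z.1, clamp (val z.2 * 2 - 1))); split.
- apply: paste.
  + by cts.
  + apply: (cts_comp cF); by cts.
  + apply: (cts_comp cG); by cts.
  + move=> [s t] /= t0; rewrite t0 clamp0 G0.
    have -> : sval t * 2 = 1 :> R by lra.
    by rewrite clamp1 F1.
- move=> s; rewrite /= mul0r sub0r oppr_le0 ler01 clamp0; exact: F0.
- move=> s; rewrite /= ifF; last by apply/negbTE; rewrite -ltNge; lra.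
  by rewrite (_ : 1 * 2 - 1 = 1 :> R) ?clamp1 ?G1//; lra.
Qed.

Lemma homotopic_compl (S T U : topologicalType) (f g : S -> T) (k : T -> U) :
  continuous k -> homotopic R f g -> homotopic R (k \o f) (k \o g).
Proof.
move=> ck [F [cF F0 F1]]; exists (k \o F); split => [|s|s]/=.
- exact: cts_comp.
- by rewrite F0.
- by rewrite F1.
Qed.

Lemma homotopic_compr (S T U : topologicalType) (f g : S -> T) (k : U -> S) :
  continuous k -> homotopic R f g -> homotopic R (f \o k) (g \o k).
Proof.
move=> ck [F [cF F0 F1]]; exists (fun z => F (k z.1, z.2)); split => [|s|s]/=.
- apply: (cts_comp cF); apply: cts_pair; last by cts.
  by apply: (cts_comp ck); cts.
- by rewrite F0.
- by rewrite F1.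
Qed.

Lemma homotopy_equivalent_trans (S T U : topologicalType) :
  homotopy_equivalent R S T -> homotopy_equivalent R T U ->
  homotopy_equivalent R S U.
Proof.
move=> [f [f' [cf cf' ff' f'f]]] [g [g' [cg cg' gg' g'g]]].
exists (g \o f), (f' \o g'); split.
- exact: cts_comp.
- exact: cts_comp.
- apply: homotopic_trans ff'.
  by have := homotopic_compr cf (homotopic_compl cf' gg').
- apply: homotopic_trans g'g.
  by have := homotopic_compr cg' (homotopic_compl cg f'f).
Qed.

Lemma homotopy_equivalent_sym (S T : topologicalType) :
  homotopy_equivalent R S T -> homotopy_equivalent R T S.
Proof. by move=> [f [g [cf cg gf fg]]]; exists g, f; split. Qed.

End homotopy_theory.

Section double_cylinder.
Context {R : realType} {I J : Type} {A B : topologicalType}.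
Context {L : J -> topologicalType}.
Local Notation unit := (unit_interval R).

(* [T] is the double mapping cylinder of the maps [phi i j] and of the
   projections from the [B * L j] to the i-th copy of [B]. The universal property
   is stated for [T * unit], so that it provides homotopies as well as maps. *)
Record double_cylinder (phi : forall (i : I) (j : J), B * L j -> A)
    (T : topologicalType) (al : A -> T) (be : I -> B -> T)
    (ep : forall (i : I) j, B * L j * unit -> T) : Prop := DoubleCylinder {
  cyl_al_continuous : continuous al;
  cyl_be_continuous : forall i, continuous (be i);
  cyl_ep_continuous : forall i j, continuous (ep i j);
  cyl_ep0 : forall i j y, ep i j (y, unit0) = al (phi i j y);
  cyl_ep1 : forall i j y, ep i j (y, unit1) = be i y.1;
  cyl_cover : forall t, [\/ exists a, t = al a, exists i b, t = be i b
    | exists i j y s, t = ep i j (y, s)];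
  cyl_universal : forall (Z : topologicalType) (al' : A * unit -> Z)
      (be' : I -> B * unit -> Z) (ep' : forall i j, B * L j * unit * unit -> Z),
    continuous al' -> (forall i, continuous (be' i)) ->
    (forall i j, continuous (ep' i j)) ->
    (forall i j y s, ep' i j (y, unit0, s) = al' (phi i j y, s)) ->
    (forall i j y s, ep' i j (y, unit1, s) = be' i (y.1, s)) ->
    exists f : T * unit -> Z,
      [/\ continuous f, forall a s, f (al a, s) = al' (a, s),
          forall i b s, f (be i b, s) = be' i (b, s)
        & forall i j z s, f (ep i j z, s) = ep' i j (z, s)] }.

Arguments cyl_al_continuous {phi T al be ep} c : rename.
Arguments cyl_be_continuous {phi T al be ep} c i : rename.
Arguments cyl_ep_continuous {phi T al be ep} c i j : rename.

Section universal.
Unset Implicit Arguments.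
Context (phi : forall (i : I) (j : J), B * L j -> A) (T : topologicalType).
Context (al : A -> T) (be : I -> B -> T) (ep : forall (i : I) j, B * L j * unit -> T).
Hypothesis cyl : double_cylinder phi al be ep.
Set Implicit Arguments.

Lemma cyl_map (Z : topologicalType) (al' : A -> Z)
    (be' : I -> B -> Z) (ep' : forall (i : I) j, B * L j * unit -> Z) :
  continuous al' -> (forall i, continuous (be' i)) ->
  (forall i j, continuous (ep' i j)) ->
  (forall i j y, ep' i j (y, unit0) = al' (phi i j y)) ->
  (forall i j y, ep' i j (y, unit1) = be' i y.1) ->
  exists f : T -> Z,
    [/\ continuous f, forall a, f (al a) = al' a,
        forall i b, f (be i b) = be' i b
      & forall i j z, f (ep i j z) = ep' i j z].
Proof.
move=> cal cbe cep ep0 ep1.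
have [|i|i j|i j y s|i j y s|f [cf fal fbe fep]] := @cyl_universal _ _ _ _ _ cyl
    Z (al' \o fst) (fun i => be' i \o fst) (fun i j => ep' i j \o fst).
- by apply: (cts_comp cal); cts.
- by apply: (cts_comp (cbe i)); cts.
- by apply: (cts_comp (cep i j)); cts.
- exact: ep0.
- exact: ep1.
exists (fun t => f (t, unit0)); split.
- by apply: (cts_comp cf); apply: cts_pair; [exact: cts_id|exact: cts_cst].
- by move=> a; rewrite fal.
- by move=> i b; rewrite fbe.
- by move=> i j z; rewrite fep.
Qed.

End universal.

Section shift.
Unset Implicit Arguments.
Context (phi phi' : forall (i : I) (j : J), B * L j -> A).
Context (T T' : topologicalType).
Context (al : A -> T) (be : I -> B -> T) (ep : forall (i : I) j, B * L j * unit -> T).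
Context (al' : A -> T') (be' : I -> B -> T').
Context (ep' : forall (i : I) j, B * L j * unit -> T').
Hypothesis cyl : double_cylinder phi al be ep.
Hypothesis cyl' : double_cylinder phi' al' be' ep'.
Context (H H' : forall (i : I) j, B * L j * unit -> A).
Hypothesis cH : forall i j, continuous (H i j).
Hypothesis H0 : forall i j y, H i j (y, unit0) = phi i j y.
Hypothesis H1 : forall i j y, H i j (y, unit1) = phi' i j y.
Hypothesis H'E : forall i j y (t : unit),
  H' i j (y, t) = H i j (y, clamp (1 - val t)).
Set Implicit Arguments.

(* Edges run along the homotopy first, then along the edge of the target. *)
Lemma cyl_shift : exists f : T -> T',
  [/\ continuous f, forall a, f (al a) = al' a,
      forall i b, f (be i b) = be' i b
    & forall i j y t, f (ep i j (y, t)) =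
        if val t * 2 - 1 <= 0 then al' (H i j (y, clamp (val t * 2)))
        else ep' i j (y, clamp (val t * 2 - 1))].
Proof.
pose epf i j (z : B * L j * unit) :=
  if val z.2 * 2 - 1 <= 0 then al' (H i j (z.1, clamp (val z.2 * 2)))
  else ep' i j (z.1, clamp (val z.2 * 2 - 1)).
have [||i j|i j y|i j y|f [cf fal fbe fep]] := @cyl_map _ _ _ _ _ cyl T' al' be' epf.
- exact: (cyl_al_continuous cyl').
- exact: (cyl_be_continuous cyl').
- apply: paste.
  + by cts.
  + apply: (cts_comp (cyl_al_continuous cyl')); apply: (cts_comp (cH i j)).
    by cts.
  + apply: (cts_comp (cyl_ep_continuous cyl' i j)).
    by cts.
  + move=> [y t] /= t0; rewrite t0 clamp0 (cyl_ep0 cyl').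
    have -> : sval t * 2 = 1 :> R by lra.
    by rewrite clamp1 H1.
- by rewrite /epf /= mul0r sub0r oppr_le0 ler01 clamp0 H0.
- rewrite /epf /= ifF; last by apply/negbTE; rewrite -ltNge; lra.
  rewrite (_ : 1 * 2 - 1 = 1 :> R) ?clamp1 ?(cyl_ep1 cyl')//; lra.
- by exists f; split => // i j y t; rewrite fep.
Qed.

(* The composite edge path retraces the homotopy; it is contracted to the plain
   edge through the paths at height [u] in the edge extended by the homotopy. *)
Lemma cyl_shiftK (f : T -> T') (g : T' -> T) :
  (forall a, f (al a) = al' a) -> (forall i b, f (be i b) = be' i b) ->
  (forall i j y t, f (ep i j (y, t)) =
     if val t * 2 - 1 <= 0 then al' (H i j (y, clamp (val t * 2)))
     else ep' i j (y, clamp (val t * 2 - 1))) ->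
  (forall a, g (al' a) = al a) -> (forall i b, g (be' i b) = be i b) ->
  (forall i j y t, g (ep' i j (y, t)) =
     if val t * 2 - 1 <= 0 then al (H' i j (y, clamp (val t * 2)))
     else ep i j (y, clamp (val t * 2 - 1))) ->
  homotopic R (g \o f) id.
Proof.
move=> fal fbe fep gal gbe gep.
(* At time 0 the composite runs along [H] for [t] up to 1/2, back until 3/4, then along the edge at
   height [4t - 3]; at time 1 it is the edge at height [t]. [u] interpolates the two heights. A
   height [u <= 0] means the point of [H] at parameter [min(2t, -u)]: the first entry is the way
   out, the second the way back. *)
pose u (t s : unit) : R := (1 - val s) * (val t * 4 - 3) + val s * val t.
pose epK i j (z : B * L j * unit * unit) :=
  if u z.1.2 z.2 <= 0
  then al (H i j (z.1.1, clamp (Num.min (val z.1.2 * 2) (- u z.1.2 z.2))))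
  else ep i j (z.1.1, clamp (u z.1.2 z.2)).
have cu j : continuous (fun z : B * L j * unit * unit => u z.1.2 z.2).
  by rewrite /u; cts.
have c11 j : continuous (fun z : B * L j * unit * unit => z.1.1) by cts.
have [||i j|i j y s|i j y s|K [cK Kal Kbe Kep]] :=
    @cyl_universal _ _ _ _ _ cyl T (al \o fst) (fun i => be i \o fst) epK.
- exact: (cts_comp (cyl_al_continuous cyl) (cts_fst cts_id)).
- move=> i; exact: (cts_comp (cyl_be_continuous cyl i) (cts_fst cts_id)).
- apply: paste; first exact: cu.
  + apply: (cts_comp (cyl_al_continuous cyl)); apply: (cts_comp (cH i j)).
    have cuj := cu j; by cts.
  + apply: (cts_comp (cyl_ep_continuous cyl i j)).
    have cuj := cu j; by cts.
  + move=> [[y t] s] /= us; rewrite us oppr0 clamp0 (cyl_ep0 cyl) clamp_le0 ?H0//.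
    by rewrite ge_min lexx orbT.
- rewrite /epK /= ifT; last first.
    by rewrite /u /=; have := val_unit_le1 s; rewrite /=; nra.
  by rewrite mul0r clamp_le0 ?H0// ge_min lexx.
- rewrite /epK /= (_ : u _ _ = 1); last by rewrite /u /=; ring.
  by rewrite clamp1 (cyl_ep1 cyl) ifF//; apply/negbTE; rewrite -ltNge ltr01.
- exists K; split => // t; have [[a ->]|[i [b ->]]|[i [j [y [s ->]]]]] := cyl_cover cyl t.
  + by rewrite Kal /= fal gal.
  + by rewrite Kbe /= fbe gbe.
  + rewrite Kep /epK /= fep; have := val_unit_ge0 s; have := val_unit_le1 s.
    have -> : u s unit0 = val s * 4 - 3 by rewrite /u /=; ring.
    rewrite /=; move: (sval s : R) => v v1 v0.
    have [vh|vh] := leP (v * 2 - 1) 0.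
      rewrite gal ifT; last by lra.
      by rewrite min_l//; lra.
    rewrite gep val_clamp; [|lra|lra].
    rewrite (_ : (v * 2 - 1) * 2 - 1 = v * 4 - 3); last by ring.
    case: ifP => // v3; rewrite H'E val_clamp; [|lra|lra].
    rewrite min_r; last by lra.
    by congr (al (H _ _ (_, clamp _))); ring.
  + by rewrite Kal.
  + by rewrite Kbe.
  + rewrite Kep /epK /=; have -> : u s unit1 = val s by rewrite /u /=; ring.
    case: ifP => [s0|_]; last by rewrite clampK.
    have -> : s = unit0.
      by apply: val_inj; apply/eqP; rewrite eq_le val_unit_ge0 andbT.
    by rewrite /= mul0r oppr0 minxx clamp0 H0 (cyl_ep0 cyl).
Qed.

End shift.

Lemma cyl_homotopy_invariance (phi phi' : forall (i : I) (j : J), B * L j -> A)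
    (T T' : topologicalType)
    (al : A -> T) (be : I -> B -> T) (ep : forall (i : I) j, B * L j * unit -> T)
    (al' : A -> T') (be' : I -> B -> T')
    (ep' : forall (i : I) j, B * L j * unit -> T') :
  double_cylinder phi al be ep -> double_cylinder phi' al' be' ep' ->
  (forall i j, homotopic R (phi i j) (phi' i j)) ->
  homotopy_equivalent R T T'.
Proof.
move=> cyl cyl' hphi.
pose H i j := sval (cid (hphi i j)).
have cH i j : continuous (H i j) by rewrite /H; case: cid => ? [].
have H0 i j y : H i j (y, unit0) = phi i j y by rewrite /H; case: cid => ? [].
have H1 i j y : H i j (y, unit1) = phi' i j y by rewrite /H; case: cid => ? [].
pose H' i j (z : B * L j * unit) := H i j (z.1, clamp (1 - val z.2)).
have cH' i j : continuous (H' i j).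
  apply: (cts_comp (cH i j)); by cts.
have H'0 i j y : H' i j (y, unit0) = phi' i j y by rewrite /H' /= subr0 clamp1.
have H'1 i j y : H' i j (y, unit1) = phi i j y by rewrite /H' /= subrr clamp0.
(* Reversal is an involution, so [cyl_shiftK] also applies with the two cylinders exchanged. *)
have HE i j y (t : unit) : H i j (y, t) = H' i j (y, clamp (1 - val t)).
  rewrite /H' val_clamp; last 2 first.
  - by rewrite subr_ge0; exact: val_unit_le1.
  - by rewrite gerBl; exact: val_unit_ge0.
  by rewrite subKr clampK.
have [f [cf fal fbe fep]] := cyl_shift cyl cyl' cH H0 H1.
have [g [cg gal gbe gep]] := cyl_shift cyl' cyl cH' H'0 H'1.
exists f, g; split => //.
- exact: (cyl_shiftK cyl cH H0 (fun _ _ _ _ => erefl) fal fbe fep gal gbe gep).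
- exact: (cyl_shiftK cyl' cH' H'0 HE gal gbe gep fal fbe fep).
Qed.

End double_cylinder.

Arguments cyl_al_continuous {R I J A B L phi T al be ep} c : rename.
Arguments cyl_be_continuous {R I J A B L phi T al be ep} c i : rename.
Arguments cyl_ep_continuous {R I J A B L phi T al be ep} c i j : rename.

(** * Total spaces of graphs of spaces *)

Section unit_interval.
Context {R : realType}.

Lemma unit_interval_compact : compact [set: unit_interval R].
Proof.
rewrite (_ : setT = clamp @` `[0 : R, 1]%classic); last first.
  apply/seteqP; split => // t _; exists (val t); last exact: clampK.
  exact: set_valP.
apply: continuous_compact; last exact: segment_compact.
exact/continuous_subspaceT/clamp_continuous.
Qed.

Lemma unit_interval_hausdorff : hausdorff_space (unit_interval R).
Proof.
move=> p q pq; apply: val_inj; apply: (@Rhausdorff R) => U V nU nV.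
have [t [tU tV]] := pq (val @^-1` U) (val @^-1` V)
  (@cts_val_incl _ _ p _ nU) (@cts_val_incl _ _ q _ nV).
by exists (val t).
Qed.

Lemma unit_interval_locally_compact : locally_compact [set: unit_interval R].
Proof.
move=> t _; exists setT; first exact: filterT.
by split; [exact: unit_interval_compact|exact: closedT].
Qed.

End unit_interval.

(** * Spaces with finitely many components *)

Section finitely_many_components.
Context {T : topologicalType}.

Lemma pi0_mem (C : pi0 T) : exists t, val C = connected_component [set: T] t.
Proof. by have [t _ <-] := set_valP C; exists t. Qed.

Lemma pi0_ofE (C : pi0 T) (t : T) : val C t -> pi0_of t = C.
Proof.
move=> Ct; apply: val_inj => /=; have [u uC] := pi0_mem C.
by apply/esym; rewrite -/(val C) uC; apply: same_connected_component; rewrite -uC.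
Qed.

Lemma mem_pi0_of (t : T) : t \in val (pi0_of t).
Proof. by apply/mem_set; exact: connected_component_refl. Qed.

Hypothesis fT : finite_set (pi0 T).

Lemma pi0_open (C : set T) : pi0 T C -> open C.
Proof.
move=> piC; rewrite -[C]setCK; apply: closed_openC.
rewrite (_ : ~` C = \bigcup_(D in pi0 T `\ C) D).
  apply: closed_bigcup; first exact: sub_finite_set fT.
  by move=> D [[t _ <-] _]; apply: component_closed; exact: closedT.
apply/seteqP; split => [t Ct|t [D [piD DC] Dt] Ct].
  exists (connected_component setT t); last exact: connected_component_refl.
  split; first by exists t.
  by move=> tC; apply: Ct; rewrite -tC; exact: connected_component_refl.
apply: DC; have D_t := @pi0_ofE (SigSub (mem_set piD)) t Dt.
by have := @pi0_ofE (SigSub (mem_set piC)) t Ct; rewrite D_t => -[].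
Qed.

Lemma cts_pi0 (S : topologicalType) (f : T -> S) :
  (forall C : pi0 T, continuous (fun t : val C => f (val t))) -> continuous f.
Proof.
move=> cf t; apply: (@cts_at_open _ _ f (val (pi0_of t))).
- exact/pi0_open/set_valP.
- exact: cf.
- exact/set_mem/mem_pi0_of.
Qed.

End finitely_many_components.

Section total_space.
Context {R : realType} (G : graph_of_spaces).
Local Notation I := (unit_interval R).

Definition glue_pi (z : pieces R G) : total_space R G :=
  (\pi_(quotient_topology {eq_quot (glue_equiv R G)}) z)%qT.

Lemma glue_pi_continuous : continuous glue_pi.
Proof. exact: pi_continuous. Qed.

Lemma glue_piE a b : Defs.glue a b -> glue_pi a = glue_pi b.
Proof.
move=> ab; apply/eqquotP; rewrite /= /glue_eq; apply/asboolP.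
exact: rst_step.
Qed.

Lemma glue_pi_surj t : exists z, t = glue_pi z.
Proof. by exists (repr t); rewrite /glue_pi reprK. Qed.

Lemma glue_pi0 e (y : gs_edge_space e) :
  glue_pi (existT (@piece R G) (inr e) (y, unit0)) =
  glue_pi (existT (@piece R G) (inl (gs_source e)) (gs_attach0 y)).
Proof. exact/glue_piE/Glue0. Qed.

Lemma glue_pi1 e (y : gs_edge_space e) :
  glue_pi (existT (@piece R G) (inr e) (y, unit1)) =
  glue_pi (existT (@piece R G) (inl (gs_target e)) (gs_attach1 y)).
Proof. exact/glue_piE/Glue1. Qed.

(* The product of a quotient map with the unit interval is again a quotient map:
   maps out of the product are maps into a compact-open function space. *)
Lemma total_space_universal (Z : topologicalType)
    (f : forall z, @piece R G z * I -> Z) :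
  (forall z, continuous (f z)) ->
  (forall e (y : gs_edge_space e) s,
     f (inr e) ((y, unit0), s) = f (inl (gs_source e)) (gs_attach0 y, s)) ->
  (forall e (y : gs_edge_space e) s,
     f (inr e) ((y, unit1), s) = f (inl (gs_target e)) (gs_attach1 y, s)) ->
  exists g : total_space R G * I -> Z, continuous g /\
    forall z y s, g (glue_pi (existT _ z y), s) = f z (y, s).
Proof.
move=> cf f0 f1.
pose F (a : pieces R G) : {compact-open, I -> Z} := fun s => f (projT1 a) (projT2 a, s).
have FE a b : Defs.glue a b -> F a = F b.
  by case => e y; apply/funext => s; [exact: f0|exact: f1].
have FE' a b : glue_pi a = glue_pi b -> F a = F b.
  move=> /eqquotP /= /asboolP; elim=> [? ? /FE//|//|? ? _ ->//|? ? ? _ -> _ ->//].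
pose g (t : total_space R G) : {compact-open, I -> Z} := F (repr t).
have gF a : g (glue_pi a) = F a by apply: FE'; rewrite /glue_pi reprK.
exists (fun z => g z.1 z.2); split; last by move=> z y s; rewrite /= gF.
have -> : (fun z => g z.1 z.2) = uncurry g by apply/funext => -[].
apply: continuous_uncurry.
- exact: unit_interval_locally_compact.
- exact: unit_interval_hausdorff.
- apply: (proj2 (@quotient_continuous _ {eq_quot (glue_equiv R G)}%qT _ g)).
  rewrite (_ : _ \o _ = F); last by apply/funext => a; exact: gF.
  by move=> [z y] U nU; exact: (continuous_curry_fun (cf z) nU).
- move=> t; have [[z y] ->] := glue_pi_surj t; rewrite gF.
  by apply: (cts_comp (cf z)); cts.
Qed.

End total_space.

(** * The distribution graph as a double mapping cylinder *)

Section distribution_graph_cylinder.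
Context {R : realType} {n k : nat} {A B : topologicalType}.
Context {L : 'I_k -> topologicalType}.
Unset Implicit Arguments.
Variable phi : forall (i : 'I_n) (j : 'I_k), B * L j -> A.
Hypothesis phiC : forall i j, continuous (phi i j).
Set Implicit Arguments.
Hypothesis fA : finite_set (pi0 A).
Hypothesis fB : finite_set (pi0 B).
Hypothesis fBL : forall j, finite_set (pi0 (B * L j)%type).
Local Notation I := (unit_interval R).
Local Notation G := (distribution_graph phiC).
Local Notation inA C := (inl (inl C) : gs_vertex G + gs_edge G)%type.
Local Notation inB i C := (inl (inr (i, C)) : gs_vertex G + gs_edge G)%type.
Local Notation inE i j C := (inr (existT (fun ij : 'I_n * 'I_k => pi0 (B * L ij.2)%type) (i, j) C)
  : gs_vertex G + gs_edge G)%type.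

Definition dg_al (a : A) : total_space R G :=
  glue_pi (existT (@piece R G) (inA (pi0_of a)) (SigSub (mem_pi0_of a))).

Definition dg_be (i : 'I_n) (b : B) : total_space R G :=
  glue_pi (existT (@piece R G) (inB i (pi0_of b)) (SigSub (mem_pi0_of b))).

Definition dg_ep (i : 'I_n) (j : 'I_k) (z : B * L j * I) : total_space R G :=
  glue_pi (existT (@piece R G) (inE i j (pi0_of z.1))
    (SigSub (mem_pi0_of z.1), z.2)).

(** The component computed from a point equals the given [C] only propositionally, and the type of
    the piece depends on it; the component is generalised together with its membership proof before
    substituting. *)
Lemma dg_alE (C : pi0 A) (a : val C) :
  dg_al (val a) = glue_pi (existT (@piece R G) (inA C) a).
Proof.
rewrite /dg_al; have := pi0_ofE (set_valP a).
move: (pi0_of _) (mem_pi0_of _) => D aD DC; subst D.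
by congr (glue_pi (existT _ _ _)); exact: val_inj.
Qed.

Lemma dg_beE i (C : pi0 B) (b : val C) :
  dg_be i (val b) = glue_pi (existT (@piece R G) (inB i C) b).
Proof.
rewrite /dg_be; have := pi0_ofE (set_valP b).
move: (pi0_of _) (mem_pi0_of _) => D bD DC; subst D.
by congr (glue_pi (existT _ _ _)); exact: val_inj.
Qed.

Lemma dg_epE i j (C : pi0 (B * L j)%type) (y : val C) (s : I) :
  dg_ep i (val y, s) = glue_pi (existT (@piece R G) (inE i j C) (y, s)).
Proof.
change (glue_pi (existT (@piece R G) (inE i j (pi0_of (val y)))
  (SigSub (mem_pi0_of (val y)), s)) = glue_pi (existT (@piece R G) (inE i j C) (y, s))).
have := pi0_ofE (set_valP y).
move: (pi0_of _) (mem_pi0_of _) => D yD DC; subst D.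
by have -> : SigSub yD = y by exact: val_inj.
Qed.

Lemma existT_piece_continuous z :
  continuous (fun y : @piece R G z => glue_pi (existT (@piece R G) z y)).
Proof. exact: (cts_comp (@glue_pi_continuous R G) (@existT_continuous _ _ z)). Qed.

Lemma distribution_graph_cylinder :
  double_cylinder phi dg_al dg_be dg_ep.
Proof.
split.
- apply: cts_pi0 => // C.
  exact: (cts_eq (fun a => esym (dg_alE a)) (@existT_piece_continuous (inA C))).
- move=> i; apply: cts_pi0 => // C.
  exact: (cts_eq (fun b => esym (dg_beE i b)) (@existT_piece_continuous (inB i C))).
- move=> i j z; pose C := pi0_of z.1.
  apply: (@cts_at_open _ _ (@dg_ep i j) (fst @^-1` val C)).
  + apply: open_comp; first by move=> ? _; exact: cts_fst_proj.
    exact: (pi0_open (fBL j) (set_valP C)).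
  + pose g (o : fst @^-1` val C : set (B * L j * I)) : val C * I :=
      (SigSub (mem_set (set_valP o) : (val o).1 \in val C), (val o).2).
    apply: (cts_eq (f := fun o => dg_ep i (val (g o).1, (g o).2))).
      by move=> o; rewrite [in RHS](surjective_pairing (val o)).
    apply: (cts_eq (fun o => esym (dg_epE i (g o).1 (g o).2))).
    apply: (cts_comp (@existT_piece_continuous (inE i j C))
      (f := fun o => ((g o).1, (g o).2))).
    have cg : continuous g by apply: cts_pair; [apply: cts_sub => /=; cts|cts].
    by cts.
  + exact/set_mem/mem_pi0_of.
- move=> i j y; rewrite /dg_ep /= (glue_pi0 (G := G)) -dg_alE.
  by [].
- move=> i j y; rewrite /dg_ep /= (glue_pi1 (G := G)) -dg_beE.
  by [].
- move=> t; have [[[[C|[i C]]|[[i j] C]] y] ->] := glue_pi_surj t.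
  + by constructor 1; eexists; exact/esym/(@dg_alE C y).
  + by constructor 2; exists i; eexists; exact/esym/(@dg_beE i C y).
  + constructor 3; case: y => y s.
    by exists i, j; do 2! eexists; exact/esym/(@dg_epE i j C y s).
- move=> Z al be ep cal cbe cep ep0 ep1.
  pose f (z : gs_vertex G + gs_edge G) : @piece R G z * I -> Z :=
    match z with
    | inl v => match v return @piece R G (inl v) * I -> Z with
      | inl C => fun y => al (val (y.1 : set_type (val (C : pi0 A))), y.2)
      | inr (i, C) => fun y => be i (val (y.1 : set_type (val (C : pi0 B))), y.2)
      end
    | inr (existT (i, j) C) => fun y =>
        ep i j (val (y.1.1 : set_type (val (C : pi0 (B * L j)%type))), y.1.2, y.2)
    end.
  have [|||g [cg gE]] := @total_space_universal R G Z f.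
  + move=> [[C|[i C]]|[[i j] C]] /=.
    * by apply: (cts_comp cal); cts.
    * by apply: (cts_comp (cbe i)); cts.
    * by apply: (cts_comp (cep i j)); cts.
  + by move=> [[i j] C] y s /=; rewrite ep0.
  + by move=> [[i j] C] y s /=; rewrite ep1.
  + exists g; split=> //.
    * by move=> a s; rewrite gE.
    * by move=> i b s; rewrite gE.
    * by move=> i j [y t] s; rewrite gE.
Qed.

End distribution_graph_cylinder.

(** * Cone coordinates and insertion of points *)

Section homothety.
Context {R : realType} {d : nat}.
Implicit Types (x y p : 'rV[R]_d) (c e : R).

Definition homothety x c y : 'rV[R]_d := x + c *: (y - x).

Lemma homothety1 x y : homothety x 1 y = y.
Proof. by rewrite /homothety scale1r addrC subrK. Qed.

Lemma homothety0 x y : homothety x 0 y = x.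
Proof. by rewrite /homothety scale0r addr0. Qed.

Lemma homothetyM x c e y : homothety x c (homothety x e y) = homothety x (c * e) y.
Proof. by rewrite /homothety addrAC subrr add0r scalerA. Qed.

Lemma cone_pointE x e p (s : R) : cone_point x e p s = homothety x (e * s) p.
Proof.
by rewrite /cone_point /homothety scalerBl scale1r scalerBr addrA addrAC.
Qed.

Lemma cts_homothety (S : topologicalType) x (c : S -> R) (p : S -> 'rV[R]_d) :
  continuous c -> continuous p -> continuous (fun s => homothety x (c s) (p s)).
Proof.
move=> cc cp; apply: cts_mx => i j.
apply: (@cts_eq _ _ (fun s => x i j + c s * (p s i j - x i j))).
  by move=> s; rewrite !mxE.
have cpij : continuous (fun s => p s i j) by exact: cts_coord.
by cts.
Qed.

End homothety.

Section insertion.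
Context {R : realType} {n d : nat}.
Implicit Types (p : 'rV[R]_d) (c : 'M[R]_(n, d)) (z : 'M[R]_(n.+1, d)).

Local Notation ins i p c := (@insert_point R n.+1 d i p c).

Lemma row_insert i p c : row i (ins i p c) = p.
Proof. by apply/rowP => v; rewrite !mxE unlift_none. Qed.

Lemma row_insert_lift i p c a : row (lift i a) (ins i p c) = row a c.
Proof. by apply/rowP => v; rewrite !mxE liftK !mxE. Qed.

Lemma row_row' i z a : row a (row' i z) = row (lift i a) z.
Proof. by apply/rowP => v; rewrite !mxE. Qed.

Lemma row'_insert i p c : row' i (ins i p c) = c.
Proof. by apply/row_matrixP => a; rewrite row_row' row_insert_lift. Qed.

Lemma insert_row' i z : ins i (row i z) (row' i z) = z.
Proof.
apply/row_matrixP => a; case: (unliftP i a) => [b ->|->].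
  by rewrite row_insert_lift row_row'.
by rewrite row_insert.
Qed.

Lemma cts_insert (S : topologicalType) i (p : S -> 'rV[R]_d) (c : S -> 'M[R]_(n, d)) :
  continuous p -> continuous c -> continuous (fun s => ins i (p s) (c s)).
Proof.
move=> cp cc; apply: cts_mx => a v; case: (unliftP i a) => [b ->|->].
  apply: (cts_eq (f := fun s => c s b v)); last exact: cts_coord.
  by move=> s; rewrite mxE liftK mxE.
apply: (cts_eq (f := fun s => p s 0 v)); last exact: cts_coord.
by move=> s; rewrite mxE unlift_none.
Qed.

Lemma cts_row (S : topologicalType) m (z : S -> 'M[R]_(m, d)) a :
  continuous z -> continuous (fun s => row a (z s)).
Proof.
move=> cz; apply: cts_mx => i v; apply: (cts_eq (f := fun s => z s a v)).
  by move=> s; rewrite mxE.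
exact: cts_coord.
Qed.

Lemma cts_row' (S : topologicalType) i (z : S -> 'M[R]_(n.+1, d)) :
  continuous z -> continuous (fun s => row' i (z s)).
Proof.
move=> cz; apply: cts_mx => a v; apply: (cts_eq (f := fun s => z s (lift i a) v)).
  by move=> s; rewrite mxE.
exact: cts_coord.
Qed.

Lemma conf_row' (Y : set 'rV[R]_d) i z : conf n.+1 Y z -> conf n Y (row' i z).
Proof.
move=> [Yz injz]; split=> [a|a b]; rewrite !row_row'//.
by move=> /injz /lift_inj.
Qed.

Lemma conf_insert (Y : set 'rV[R]_d) i p c : Y p -> conf n Y c ->
  (forall a, p <> row a c) -> conf n.+1 Y (ins i p c).
Proof.
move=> Yp [Yc injc] pc; split=> [a|a b].
  by case: (unliftP i a) => [b ->|->]; rewrite ?row_insert_lift ?row_insert.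
case: (unliftP i a) => [a' ->|->]; case: (unliftP i b) => [b' ->|->];
  rewrite ?row_insert_lift ?row_insert//.
- by move=> /injc ->.
- by move=> /esym /pc.
- by move=> /pc.
Qed.

End insertion.

(* [h] is the distance to [x] in cone coordinates, cut off at 1: it is the radius
   of a point of the star of [x], and is 1 outside the open star. *)
Record cone_structure (R : realType) (d : nat) (X : set 'rV[R]_d) (x : 'rV[R]_d)
    (h : 'rV[R]_d -> R) (Lk : set 'rV[R]_d) : Prop := ConeStructure {
  cone_center : X x;
  cone_ge0 : forall y, X y -> 0 <= h y;
  cone_le1 : forall y, X y -> h y <= 1;
  cone_center0 : h x = 0;
  cone_eq0 : forall y, X y -> h y = 0 -> y = x;
  cone_within : {within X, continuous h};
  cone_scale : forall y c, X y -> h y < 1 -> 0 <= c -> c * h y <= 1 ->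
    X (homothety x c y) /\ h (homothety x c y) = c * h y;
  cone_link : forall p c, Lk p -> 0 <= c <= 1 ->
    X (homothety x c p) /\ h (homothety x c p) = c;
  cone_radial : forall y, X y -> 0 < h y < 1 -> Lk (homothety x (h y)^-1 y) }.

Section cone.
Context {R : realType} {d : nat} {X : set 'rV[R]_d} {x : 'rV[R]_d}.
Context {h : 'rV[R]_d -> R} {Lk : set 'rV[R]_d}.
Hypothesis cs : cone_structure X x h Lk.

Lemma cone_continuous (S : topologicalType) (f : S -> 'rV[R]_d) :
  continuous f -> (forall s, X (f s)) -> continuous (fun s => h (f s)).
Proof.
move=> cf Xf; pose g s : X := SigSub (mem_set (Xf s)).
have cg : continuous g by exact: cts_sub.
have /subspace_sigL_continuousP ch := cone_within cs.
exact: (cts_comp ch cg).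
Qed.

Lemma cone_gt0 y : X y -> y <> x -> 0 < h y.
Proof.
move=> Xy yx; rewrite lt_neqAle (cone_ge0 cs)// andbT eq_sym.
by apply/eqP => /(cone_eq0 cs Xy).
Qed.

Lemma cone_gt0_neq y : 0 < h y -> y <> x.
Proof. by move=> + yx; rewrite yx (cone_center0 cs) ltxx. Qed.

Section product.
Context {n : nat}.
Implicit Types c : 'M[R]_(n, d).

(* Plays the role of the minimum of the [h (row l c)], which it bounds from below. *)
Definition room c : R := \prod_(l < n) h (row l c).

Lemma room_gt0 c : (forall l, (X `\ x) (row l c)) -> 0 < room c.
Proof. by move=> Xc; apply: prodr_gt0 => l _; apply: cone_gt0; case: (Xc l). Qed.

Lemma room_le1 c : (forall l, X (row l c)) -> room c <= 1.
Proof.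
by move=> Xc; apply: prodr_ile1 => l _; rewrite (cone_ge0 cs)// (cone_le1 cs).
Qed.

Lemma room_le c l : (forall l, X (row l c)) -> room c <= h (row l c).
Proof.
move=> Xc; rewrite /room (bigD1 l)//= ler_piMr ?(cone_ge0 cs)//.
by apply: prodr_ile1 => i _; rewrite (cone_ge0 cs)// (cone_le1 cs).
Qed.

Lemma room_neq c : (forall l, X (row l c)) -> 0 < room c ->
  forall l, (X `\ x) (row l c).
Proof.
move=> Xc c0 l; split => //; apply: cone_gt0_neq.
exact: lt_le_trans c0 (room_le _ _).
Qed.

Lemma cts_room (S : topologicalType) (c : S -> 'M[R]_(n, d)) :
  continuous c -> (forall s l, X (row l (c s))) -> continuous (fun s => room (c s)).
Proof.
move=> cc Xc; apply: cts_prod => l; apply: cone_continuous => //.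
exact: cts_row.
Qed.

End product.

End cone.

Arguments room {R d} h {n} c.

(** * Configurations with a point near the center *)

(** What the geometry near [x] requires of the components of the link: relative openness makes the
    chart domains open, and compactness gives uniformity in the direction at the center. *)
Record link_pieces (R : realType) (d : nat) (Lk : set 'rV[R]_d) (k : nat)
    (L : 'I_k -> set 'rV[R]_d) : Prop := LinkPieces {
  piece_sub : forall j, L j `<=` Lk;
  piece_cover : forall p, Lk p -> exists j, L j p;
  piece_disjoint : forall j j' p, L j p -> L j' p -> j = j';
  piece_compact : forall j, compact (L j);
  piece_open : forall j, exists2 O, open O & L j = Lk `&` O }.

Section near_center.
Context {R : realType} {d : nat} {X : set 'rV[R]_d} {x : 'rV[R]_d}.
Context {h : 'rV[R]_d -> R} {Lk : set 'rV[R]_d}.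
Hypothesis cs : cone_structure X x h Lk.
Context {n k : nat} {L : 'I_k -> set 'rV[R]_d}.
Hypothesis ls : link_pieces Lk L.

Local Notation I := (unit_interval R).
Local Notation Xx := (X `\ x).
Local Notation FX := (conf n.+1 X).
Local Notation A := (conf n.+1 Xx).
Local Notation B := (conf n Xx).
Local Notation V := (`]0 : R, 2[%classic).
Local Notation ins i p c := (@insert_point R n.+1 d i p c).

Lemma confB_X (c : B) l : X (row l (val c)).
Proof. by have [/(_ l) []] := set_valP c. Qed.

Lemma confB_Xx (c : B) l : Xx (row l (val c)).
Proof. by have [/(_ l)] := set_valP c. Qed.

(** Heights alone keep the inserted point apart from the others. *)
Lemma conf_near_X i (c : B) p t : Lk p -> 0 <= t <= 1 ->
  (forall l, t < h (row l (val c))) -> FX (ins i (homothety x t p) (val c)).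
Proof.
move=> Lp t01 tc; have [Xp hp] := cone_link cs Lp t01.
apply: conf_insert => //.
  by have [Yc injc] := set_valP c; split => // l; exact: confB_X.
by move=> l pl; have := tc l; rewrite -pl hp ltxx.
Qed.

Lemma conf_near_Xx i (c : B) p t : Lk p -> 0 < t <= 1 ->
  (forall l, t < h (row l (val c))) -> A (ins i (homothety x t p) (val c)).
Proof.
move=> Lp /andP[t0 t1] tc.
have [|Xp hp] := cone_link cs Lp (c := t); first by rewrite ltW.
apply: conf_insert.
- by split => //; apply: (cone_gt0_neq cs); rewrite hp.
- exact: set_valP.
- by move=> l pl; have := tc l; rewrite -pl hp ltxx.
Qed.

(** The center is at [v = 0], the seam at [v = 1]. At [v = 2] the radius reaches [room], below which
    no other point can be met; hence the open range [V] of [v]. *)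
Definition radius (v : R) (c : B) : R := v * room h (val c) / 2.

Lemma room_pos (c : B) : 0 < room h (val c).
Proof. exact: (room_gt0 cs (confB_Xx c)). Qed.

Lemma radius_lt v (c : B) : v < 2 -> radius v c < room h (val c).
Proof. by move=> v2; have := room_pos c; rewrite /radius; nra. Qed.

Lemma radius_lt_h v (c : B) l : v < 2 -> radius v c < h (row l (val c)).
Proof.
move=> /radius_lt v2; apply: lt_le_trans (v2 _) _.
exact/(room_le cs)/confB_X.
Qed.

Lemma radius_le1 v (c : B) : v < 2 -> radius v c <= 1.
Proof.
move=> /radius_lt v2; apply: le_trans (ltW (v2 _)) _.
exact/(room_le1 cs)/confB_X.
Qed.

Lemma radius_ge0 v (c : B) : 0 <= v -> 0 <= radius v c.
Proof. by move=> v0; have := room_pos c; rewrite /radius; nra. Qed.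

Lemma radius_gt0 v (c : B) : 0 < v -> 0 < radius v c.
Proof. by move=> v0; have := room_pos c; rewrite /radius; nra. Qed.

Lemma cts_radius (S : topologicalType) (v : S -> R) (c : S -> B) :
  continuous v -> continuous c -> continuous (fun s => radius (v s) (c s)).
Proof.
move=> cv cc; rewrite /radius; apply: ctsM; last exact: cts_cst.
apply: ctsM => //.
by apply: (cts_room cs); [cts|move=> s l; exact: confB_X].
Qed.

Lemma val_V (v : V) : 0 < val v < 2.
Proof. by have := set_valP v; rewrite /= in_itv. Qed.

Lemma insA_subproof i j (y : B * L j * V) :
  ins i (homothety x (radius (val y.2) y.1.1) (val y.1.2)) (val y.1.1) \in A.
Proof.
have /andP[v0 v2] := val_V y.2.
apply/mem_set/conf_near_Xx; first exact/(piece_sub ls)/set_valP.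
  by rewrite radius_gt0// radius_le1.
by move=> l; exact: radius_lt_h.
Qed.

Definition insA i j (y : B * L j * V) : A := SigSub (insA_subproof i y).

Lemma insA_continuous i j : continuous (@insA i j).
Proof.
apply: cts_sub => /=; apply: cts_insert; last by cts.
by apply: cts_homothety; [apply: cts_radius|]; cts.
Qed.

Lemma insF_subproof i j (y : B * L j * I) :
  ins i (homothety x (radius (1 - val y.2) y.1.1) (val y.1.2)) (val y.1.1) \in FX.
Proof.
have v2 : 1 - val y.2 < 2 by have := val_unit_ge0 y.2; lra.
apply/mem_set/conf_near_X; first exact/(piece_sub ls)/set_valP.
  by rewrite radius_ge0 ?radius_le1// subr_ge0 val_unit_le1.
by move=> l; exact: radius_lt_h.
Qed.

Definition insF i j (y : B * L j * I) : FX := SigSub (insF_subproof i y).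

Lemma insF_continuous i j : continuous (@insF i j).
Proof.
apply: cts_sub => /=; apply: cts_insert; last by cts.
by apply: cts_homothety; [apply: cts_radius|]; cts.
Qed.

Lemma insx_subproof i (c : B) : ins i x (val c) \in FX.
Proof.
apply/mem_set/conf_insert; first exact: cone_center cs.
  by have [Yc injc] := set_valP c; split => // l; exact: confB_X.
by move=> l /esym xl; have [_] := confB_Xx c l; exact.
Qed.

Definition insx i (c : B) : FX := SigSub (insx_subproof i c).

Lemma insx_continuous i : continuous (insx i).
Proof. by apply: cts_sub => /=; apply: cts_insert; cts. Qed.

Definition inclA : A -> FX := subfun (conf_subset (@subDsetl _ X [set x])).

Lemma inclA_continuous : continuous inclA.
Proof. by apply: cts_sub => /=; cts. Qed.

Lemma V1_subproof : 1 \in V.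
Proof. by apply/mem_set; rewrite /= in_itv/= ltr01; lra. Qed.

Definition V1 : V := SigSub V1_subproof.

Definition phi1 i j (y : B * L j) : A := insA i (y, V1).

Lemma phi1_continuous i j : continuous (@phi1 i j).
Proof. by apply: (cts_comp (@insA_continuous i j)); cts. Qed.

(* Only the radius of the inserted point matters up to homotopy, as long as it
   stays below those of the other points. *)
Lemma homotopic_phi1 i j (rho : B -> B) (tau : R) (phi : B * L j -> A) :
  continuous rho -> homotopic R rho id -> 0 < tau <= 1 ->
  (forall c l, tau < h (row l (val (rho c)))) ->
  (forall y, val (phi y) = ins i (homothety x tau (val y.2)) (val (rho y.1))) ->
  homotopic R phi (@phi1 i j).
Proof.
move=> crho [H [cH H0 H1]] /andP[tau0 tau1] tau_h phiE.
(* The radius is adjusted while the other points stay at [rho]. When these then move from [rho] to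
   the identity, [phi1] adapts its radius to them at every time, so no collision occurs. *)
apply: (@homotopic_trans _ _ _ _ (fun y => phi1 i (rho y.1, y.2))); last first.
  exists (fun z => phi1 i (H (z.1.1, z.2), z.1.2)); split.
  - apply: (cts_comp (@phi1_continuous i j)).
    apply: cts_pair; last by cts.
    by apply: (cts_comp cH); cts.
  - by move=> y; rewrite H0.
  - by move=> y; rewrite H1; case: y.
pose t (z : B * L j * I) := (1 - val z.2) * tau + val z.2 * radius 1 (rho z.1.1).
have t_in z : t z \in `]0, 1] /\ forall l, t z < h (row l (val (rho z.1.1))).
  have := val_unit_ge0 z.2; have := val_unit_le1 z.2.
  have := radius_gt0 (rho z.1.1) (@ltr01 R).
  have := @radius_le1 1 (rho z.1.1); rewrite /t.
  set r := radius _ _; move: (val z.2 : R) => s r1 r0 s1 s0.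
  have {}r1 : r <= 1 by apply: r1; lra.
  split; first by rewrite in_itv/=; apply/andP; split; nra.
  move=> l; have := tau_h z.1.1 l.
  have : r < h (row l (val (rho z.1.1))) by apply: radius_lt_h; lra.
  by move: (h _) => hl; have [?|?] := leP tau r; nra.
have ctsrho : continuous (fun z : B * L j * I => rho z.1.1).
  by apply: (cts_comp crho); cts.
pose P z := ins i (homothety x (t z) (val z.1.2)) (val (rho z.1.1)).
have PA z : P z \in A.
  apply/mem_set/conf_near_Xx; first exact/(piece_sub ls)/set_valP.
    by have [] := t_in z; rewrite in_itv.
  by have [] := t_in z.
exists (fun z => SigSub (PA z)); split.
- apply: cts_sub; apply: cts_insert; last by cts.
  apply: cts_homothety; last by cts.
  have cr : continuous (fun z : B * L j * I => radius 1 (rho z.1.1)).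
    by apply: cts_radius; cts.
  by rewrite /t; cts.
- move=> y; apply: val_inj; rewrite phiE /= /P /t /=.
  by rewrite subr0 mul1r mul0r addr0.
- move=> y; apply: val_inj; rewrite /= /P /t /=.
  by rewrite subrr mul1r mul0r add0r.
Qed.

(** * Charts of [A] near the center *)

Lemma row_insA i j (y : B * L j * V) :
  row i (val (insA i y)) = homothety x (radius (val y.2) y.1.1) (val y.1.2).
Proof. exact: row_insert. Qed.

Lemma row'_insA i j (y : B * L j * V) : row' i (val (insA i y)) = val y.1.1.
Proof. exact: row'_insert. Qed.

Lemma h_insA i j (y : B * L j * V) :
  h (row i (val (insA i y))) = radius (val y.2) y.1.1.
Proof.
have /andP[v0 v2] := val_V y.2.
rewrite row_insA; apply: (proj2 (cone_link cs _ _)).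
  exact/(piece_sub ls)/set_valP.
by rewrite radius_ge0 ?radius_le1// ltW.
Qed.

(** The inserted point is strictly the lowest one, which recovers [i]; its row, its height and the
    remaining rows then give [v], the link point and the rest, and disjointness of the pieces gives
    [j]. As [y] and [y'] have different types until [j = j'] is known, injectivity is expressed
    through an arbitrary function [Q] of the data. *)
Lemma insA_inj i j (y : B * L j * V) i' j' (y' : B * L j' * V)
    (T : Type) (Q : forall i j, B * L j * V -> T) :
  insA i y = insA i' y' -> Q i j y = Q i' j' y'.
Proof.
have lt_row a b (y1 : B * L b * V) l : h (row a (val (insA a y1))) <
    h (row (lift a l) (val (insA a y1))).
  have /andP[_ v2] := val_V y1.2.
  by rewrite h_insA row_insert_lift radius_lt_h.
move=> e; have ii' : i = i'.
  case: (unliftP i i') => [a i'E|->//].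
  have := lt_row i _ y a; case: (unliftP i' i) => [b iE|->//]; rewrite -i'E.
  have := lt_row i' _ y' b; rewrite -e -iE => lt1 lt2.
  by have := lt_trans lt1 lt2; rewrite ltxx.
subst i'; have := congr1 (fun z : A => row' i (val z)) e.
rewrite !row'_insA; have := congr1 (fun z : A => h (row i (val z))) e.
rewrite !h_insA; have := congr1 (fun z : A => row i (val z)) e.
rewrite !row_insA; case: y y' {e} => [[c p] v] [[c' p'] v'] /= ep ev /val_inj ec.
subst c'; have vv' : v = v'.
  have i2 : (2 : R)^-1 != 0 by rewrite invr_eq0 pnatr_eq0.
  by apply: val_inj; apply: (mulIf (lt0r_neq0 (room_pos c))); exact: (mulIf i2 ev).
subst v'; have r0 : radius (val v) c != 0.
  by have /andP[v0 _] := val_V v; rewrite gt_eqF// radius_gt0.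
have {}ep : val p = val p'.
  have /(congr1 (homothety x (radius (val v) c)^-1)) := ep.
  by rewrite !homothetyM mulVf// !homothety1.
have jj' : j = j'.
  by apply: (piece_disjoint ls (set_valP p)); rewrite -/(val p) ep; exact: set_valP.
by subst j'; have -> : p = p' by exact: val_inj.
Qed.

Lemma confA_h_gt0 (z : A) i : 0 < h (row i (val z)).
Proof. by have [/(_ i) [Xz zx] _] := set_valP z; exact: (cone_gt0 cs Xz zx). Qed.

Lemma confA_X (z : A) i : X (row i (val z)).
Proof. by have [/(_ i) []] := set_valP z. Qed.

Lemma cts_hrow (S : topologicalType) (f : S -> A) i : continuous f ->
  continuous (fun s => h (row i (val (f s)))).
Proof.
move=> cf; apply: (cone_continuous cs); first by apply: cts_row; cts.
by move=> s; exact: confA_X.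
Qed.

Definition radial i (z : A) := homothety x (h (row i (val z)))^-1 (row i (val z)).

Lemma radial_continuous i : continuous (radial i).
Proof.
apply: cts_homothety; last by apply: cts_row; cts.
apply: ctsV; first by move=> s; rewrite gt_eqF// confA_h_gt0.
by apply: cts_hrow; cts.
Qed.

(** The image of [insA i] on the [j]-th piece; [chart] inverts [insA] on it. *)
Definition chart_dom i j : set A :=
  [set z | h (row i (val z)) < room h (row' i (val z)) /\ L j (radial i z)].

Lemma close_lt1 i (z : A) :
  h (row i (val z)) < room h (row' i (val z)) -> h (row i (val z)) < 1.
Proof.
move=> /lt_le_trans; apply; apply: (room_le1 cs) => l.
by rewrite row_row'; exact: confA_X.
Qed.

Lemma radial_link i (z : A) :
  h (row i (val z)) < room h (row' i (val z)) -> Lk (radial i z).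
Proof.
move=> z1; apply: (cone_radial cs); first exact: confA_X.
by rewrite confA_h_gt0 close_lt1.
Qed.

Lemma chart_dom_open i j : open (chart_dom i j).
Proof.
have [U oU LjE] := piece_open ls j.
rewrite (_ : chart_dom i j =
  [set z | h (row i (val z)) < room h (row' i (val z))] `&` radial i @^-1` U).
  apply: openI; last by apply: open_comp => // z _; exact: radial_continuous.
  apply: open_lt_cts; first by apply: cts_hrow; cts.
  apply: (cts_room cs); first by apply: cts_row'; cts.
  by move=> z l; rewrite row_row'; exact: confA_X.
apply/seteqP; split=> z [z1 zL]; split=> //; first by move: zL; rewrite LjE => -[].
by rewrite LjE; split => //; exact: radial_link.
Qed.

Lemma row'_confB i (z : A) : row' i (val z) \in B.
Proof. by apply/mem_set/conf_row'; exact: set_valP. Qed.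

Definition rest i (z : A) : B := SigSub (row'_confB i z).

Lemma chart_radius_subproof i j (o : chart_dom i j) :
  h (row i (val (val o))) * 2 / room h (row' i (val (val o))) \in V.
Proof.
have [+ _] := set_valP o => zr; have o0 := room_pos (rest i (val o)).
apply/mem_set; rewrite /= in_itv /= divr_gt0 ?mulr_gt0 ?confA_h_gt0//=.
by rewrite ltr_pdivrMr// mulrC ltr_pM2l.
Qed.

Definition chart i j (o : chart_dom i j) : B * L j * V :=
  (rest i (val o), SigSub (mem_set (proj2 (set_valP o))),
   SigSub (chart_radius_subproof o)).

Lemma chart_continuous i j : continuous (@chart i j).
Proof.
have crow' : continuous (fun o : chart_dom i j => row' i (val (val o))).
  by apply: cts_row'; cts.
apply: cts_pair; first apply: cts_pair.
- exact: cts_sub.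
- by apply: cts_sub; apply: (cts_comp (@radial_continuous i)); cts.
- apply: cts_sub; apply: ctsM; last apply: ctsV.
  + by apply: ctsM; [apply: cts_hrow; cts|cts].
  + by move=> o; rewrite gt_eqF// (room_pos (rest i (val o))).
  + apply: (cts_room cs) => // o l; rewrite row_row'; exact: confA_X.
Qed.

Lemma chartK i j (o : chart_dom i j) : insA i (chart o) = val o.
Proof.
apply: val_inj; rewrite -[RHS](insert_row' i); congr insert_point.
have o0 := room_pos (rest i (val o)).
rewrite /= /radius /= divfK ?gt_eqF// mulfK ?pnatr_eq0//.
by rewrite homothetyM divff ?homothety1// gt_eqF// confA_h_gt0.
Qed.

(** Configurations with [v > 1] for every index. They overlap the charts in [1 < v < 2], and
    together with the chart domains they form an open cover of [A]. *)
Definition far : set A :=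
  [set z | forall i, room h (row' i (val z)) / 2 < h (row i (val z))].

Lemma far_open : open far.
Proof.
rewrite openE => z zf.
pose P i : set A := [set y | room h (row' i (val y)) / 2 < h (row i (val y))].
apply: (@filter_forall A 'I_n.+1 P (nbhs z)) => i; apply: open_nbhs_nbhs.
split; last exact: zf; apply: open_lt_cts; last by apply: cts_hrow; cts.
apply: ctsM; last exact: cts_cst.
apply: (cts_room cs); first by apply: cts_row'; cts.
by move=> y l; rewrite row_row'; exact: confA_X.
Qed.

Lemma far_or_chart z : far z \/ exists i j, chart_dom i j z.
Proof.
have [zf|/existsNP [i /negP]] := pselect (far z); [by left|rewrite -leNgt => zi].
right; exists i; have z0 := room_pos (rest i z).
have zi' : h (row i (val z)) < room h (row' i (val z)).
  by apply: le_lt_trans zi _; rewrite /= in z0; lra.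
by have [j Lj] := piece_cover ls (radial_link zi'); exists j.
Qed.

(** * The section from configurations to the cylinder *)

Section retraction.
Context {T : topologicalType} {al : A -> T} {be : 'I_n.+1 -> B -> T}.
Unset Implicit Arguments.
Context {ep : forall (i : 'I_n.+1) j, B * L j * I -> T}.
Set Implicit Arguments.
Hypothesis cyl : double_cylinder phi1 al be ep.

(** Signed position on the line crossing the seam: negative values lie in [A] at parameter
    [1 + sigma], positive ones in the edge at time [sigma]. It moves linearly from [v - 1] at time 0
    to the mirror value [1 - v] at time 1. *)
Definition sigma (v : V) (s : I) : R := (1 - val v) * (val s * 2 - 1).

Lemma sigma_subproof (v : V) (s : I) : 1 + sigma v s \in V.
Proof.
apply/mem_set; rewrite /= in_itv /= /sigma; have := val_V v.
have := val_unit_ge0 s; have := val_unit_le1 s; move: (val v : R) (val s : R) => a b.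
by move=> b1 b0 /andP[a0 a2]; apply/andP; split; nra.
Qed.

Definition shiftV (v : V) (s : I) : V := SigSub (sigma_subproof v s).

(* In the chart, the points with [v < 1] are moved across the seam [v = 1], where
   [A] meets the edges, to the mirror point of the edge. *)
Definition fold i j (z : B * L j * V * I) : T :=
  if 1 - val z.1.2 <= 0 then al (insA i z.1)
  else if sigma z.1.2 z.2 <= 0 then al (insA i (z.1.1, shiftV z.1.2 z.2))
  else ep i j (z.1.1, clamp (sigma z.1.2 z.2)).

Lemma cts_sigma (S : topologicalType) (v : S -> V) (s : S -> I) :
  continuous v -> continuous s -> continuous (fun y => sigma (v y) (s y)).
Proof. by move=> cv cs'; rewrite /sigma; cts. Qed.

Lemma fold_continuous i j : continuous (@fold i j).
Proof.
have csig : continuous (fun z : B * L j * V * I => sigma z.1.2 z.2).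
  by apply: cts_sigma; cts.
apply: paste; first by cts.
- apply: (cts_comp (cyl_al_continuous cyl)).
  by apply: (cts_comp (@insA_continuous i j)); cts.
- apply: paste => //.
  + apply: (cts_comp (cyl_al_continuous cyl)).
    apply: (cts_comp (@insA_continuous i j)); apply: cts_pair; first by cts.
    by apply: cts_sub; rewrite /=; cts.
  + by apply: (cts_comp (cyl_ep_continuous cyl i j)); cts.
  + move=> [[y v] s] /= s0; rewrite s0 clamp0 (cyl_ep0 cyl) /phi1.
    by congr (al (insA _ (_, _))); apply: val_inj; rewrite /= s0 addr0.
- move=> [[y v] s] /= v1; have -> : sigma v s = 0 by rewrite /sigma v1 mul0r.
  rewrite lexx; congr (al (insA _ (_, _))); apply: val_inj.
  by rewrite /= /sigma v1 mul0r addr0; lra.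
Qed.

(** Outside all charts the default [al z.1] applies. Inside one, [insA_inj] makes the chart and the
    coordinates unique, so that [xget] involves no choice. *)
Definition push (z : A * I) : T :=
  xget (al z.1) [set t | exists i j y, insA i y = z.1 /\ t = @fold i j (y, z.2)].

Lemma push_insA i j (y : B * L j * V) s : push (insA i y, s) = fold i (y, s).
Proof.
apply: xget_unique => [|t [i' [j' [y' [e ->]]]]] /=; first by exists i, j, y.
exact: (insA_inj (fun i j y => @fold i j (y, s)) e).
Qed.

Lemma push_far z s : far z -> push (z, s) = al z.
Proof.
move=> zf; rewrite /push; case: xgetP => //= _ _ [i [j [y [yz ->]]]].
have := zf i; rewrite -yz h_insA row'_insA /radius /fold.
have r0 := room_pos y.1.1.
rewrite -mulrA ltr_pMl ?divr_gt0// => v1.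
by rewrite ifT ?yz//= subr_le0 ltW.
Qed.

Lemma push_continuous : continuous push.
Proof.
move=> [z s]; have [zf|[i [j zij]]] := far_or_chart z.
- pose D : set (A * I) := fst @^-1` far.
  apply: (@cts_at_open _ _ push D) => //.
    by apply: open_comp; [move=> ? _; exact: cts_fst_proj|exact: far_open].
  apply: (@cts_eq _ _ (fun o : D => al (val o).1)).
    by move=> o; rewrite (surjective_pairing (val o)) push_far//; exact: (set_valP o).
  by apply: (cts_comp (cyl_al_continuous cyl)); cts.
- pose D : set (A * I) := fst @^-1` chart_dom i j.
  apply: (@cts_at_open _ _ push D) => //.
    by apply: open_comp; [move=> ? _; exact: cts_fst_proj|exact: chart_dom_open].
  pose g (o : D) : chart_dom i j := 
    SigSub (mem_set (set_valP o) : (val o).1 \in chart_dom i j).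
  apply: (@cts_eq _ _ (fun o : D => fold i (chart (g o), (val o).2))).
    move=> o; rewrite [in RHS](surjective_pairing (val o)).
    by rewrite -push_insA chartK.
  apply: (cts_comp (@fold_continuous i j)); apply: cts_pair; last by cts.
  by apply: (cts_comp (@chart_continuous i j)); apply: cts_sub; rewrite /=; cts.
Qed.

Lemma push0 z : push (z, unit0) = al z.
Proof.
have [zf|[i [j zij]]] := far_or_chart z; first exact: push_far.
pose o : chart_dom i j := SigSub (mem_set zij); have /= oz := chartK o.
rewrite -oz push_insA /fold /=; case: ifP => // v1.
have s0 : sigma (chart o).2 unit0 = val (chart o).2 - 1 by rewrite /sigma /=; ring.
rewrite ifT; last by rewrite s0; move: v1 => /negbT; rewrite -ltNge /=; lra.
congr (al (insA _ _)); rewrite [RHS]surjective_pairing; congr (_, _).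
by apply: val_inj; rewrite /= s0 /=; ring.
Qed.

Lemma push_phi1 i j y s : push (@phi1 i j y, s) = al (phi1 i y).
Proof. by rewrite push_insA /fold /= subrr lexx. Qed.

Lemma push_seam i j y (v : V) : val v <= 1 ->
  push (insA i (y, v), unit1) = ep i j (y, clamp (1 - val v)).
Proof.
move=> v1; rewrite push_insA /fold /=.
have s1 : sigma v unit1 = 1 - val v by rewrite /sigma /=; ring.
case: ifP => [v1'|]; last by rewrite s1 /= => ->.
have -> : v = V1 by apply: val_inj; rewrite /=; apply: le_anti; rewrite v1 -subr_le0.
by rewrite subrr clamp0 (cyl_ep0 cyl).
Qed.

Lemma spread_exists (z : FX) : exists t,
  (exists2 a : A, val a = val z & t = push (a, unit1)) \/
  (exists i (b : B), val z = ins i x (val b) /\ t = be i b).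
Proof.
have [Xz injz] := set_valP z.
have [/existsNP [i /contrapT zi]|zx] := pselect (~ forall i, row i (val z) <> x).
  have b0 : row' i (val z) \in B.
    apply/mem_set; have [Xz' injz'] := conf_row' i (set_valP z).
    split => // a; split => //; rewrite row_row' => ax.
    by have /injz/eqP := etrans ax (esym zi); rewrite eq_sym (negbTE (neq_lift _ _)).
  exists (be i (SigSub b0)); right; exists i, (SigSub b0); split => //=.
  by rewrite -[LHS](insert_row' i) zi.
have zA : val z \in A by apply/mem_set; split => // i; split => // /= /(contrapT zx).
by exists (push (SigSub zA, unit1)); left; exists (SigSub zA).
Qed.

(** The section of the insertion map. The two clauses exclude each other and each determines the
    value, as [spread_incl] and [spread_x] show. *)
Definition spread (z : FX) : T := sval (cid (spread_exists z)).

Lemma spread_incl a : spread (inclA a) = push (a, unit1).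
Proof.
rewrite /spread; case: cid => t /= [[a' /val_inj -> //]|[i [b [az _]]]].
have ax : row i (val a) = x by rewrite (az : val a = _) row_insert.
by have [/(_ i) [_]] := set_valP a; case.
Qed.

Lemma spread_x i b : spread (insx i b) = be i b.
Proof.
rewrite /spread; case: cid => t /= [[a az _]|[i' [b' [az ->]]]].
  have ax : row i (val a) = x by rewrite (az : val a = _) row_insert.
  by have [/(_ i) [_]] := set_valP a; case.
have ii' : i = i'.
  case: (unliftP i' i) => [l il|//].
  have := congr1 (row i) az; rewrite row_insert il row_insert_lift => bx.
  by have [_] := confB_Xx b' l; case.
subst i'; congr (be i _); apply: val_inj.
by rewrite -[LHS](row'_insert i x) -az row'_insert.
Qed.

Lemma confX_X (z : FX) i : X (row i (val z)).
Proof. by have [] := set_valP z. Qed.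

Lemma cts_hrowX (S : topologicalType) (f : S -> FX) i : continuous f ->
  continuous (fun s => h (row i (val (f s)))).
Proof.
move=> cf; apply: (cone_continuous cs); first by apply: cts_row; cts.
by move=> s; exact: confX_X.
Qed.

Lemma cts_roomX (S : topologicalType) (f : S -> FX) i : continuous f ->
  continuous (fun s => room h (row' i (val (f s)))).
Proof.
move=> cf; apply: (cts_room cs); first by apply: cts_row'; cts.
by move=> s l; rewrite row_row'; exact: confX_X.
Qed.

(* Compactness of the link makes the ends of the edges shrink to the points of
   [B] uniformly in the link coordinate. *)
Lemma tube i b (W : set T) : nbhs (be i b) W ->
  \forall z \near (b, unit1 : I), forall j (p : L j), W (ep i j (z.1, p, z.2)).
Proof.
move=> nW; pose P j : set (B * I) := [set z | forall p : L j, W (ep i j (z.1, p, z.2))].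
apply: (@filter_forall (B * I)%type 'I_k P (nbhs (b, unit1 : I))) => j; rewrite /P.
have /compact_near_coveringP := @piece_compact _ _ _ _ _ ls j.
(* Membership proofs are quantified over because compactness concerns points of the ambient space,
   whereas [ep] takes points of the subtype. *)
move=> /(_ _ (nbhs (b, unit1 : I)) (fun z p =>
  forall pL : p \in L j, W (ep i j (z.1, SigSub pL, z.2)))) cover.
suff : \forall z \near (b, unit1 : I),
    L j `<=` (fun p => forall pL : p \in L j, W (ep i j (z.1, SigSub pL, z.2))).
  apply: filterS => z Wz p; have := Wz (val p) (set_valP p) (valP p).
  by rewrite (_ : SigSub _ = p)//; exact: val_inj.
apply: cover => p0 Lp0.
pose y0 : B * L j * I := (b, SigSub (mem_set Lp0), unit1).
have [[P1 P2] /= [[[Q1 Q2] /= [Q1b Q2p] Q12] P2s] P12] : nbhs y0 (ep i j @^-1` W).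
  apply: (cyl_ep_continuous cyl i j y0).
  by rewrite /y0 (cyl_ep1 cyl).
have [_ [[D oD <-] /= Dp0 DQ]] := Q2p.
exists (D, Q1 `*` P2) => /=.
  by split; [exact: open_nbhs_nbhs|exists (Q1, P2)].
move=> [p [c s]] /= [Dp [Q1c P2s']] pL.
by apply: (P12 (c, SigSub pL, s)); split => //; apply: Q12; split => //; exact: DQ.
Qed.

(** The side [v < 1] of the seam, now including height 0. Written without division, the strict
    inequality also forces [room] to be positive, so no other point sits at [x]. *)
Definition near_dom i : set FX :=
  [set z | h (row i (val z)) * 2 < room h (row' i (val z))].

Lemma near_dom_open i : open (near_dom i).
Proof.
apply: open_lt_cts; last by apply: cts_roomX; cts.
by apply: ctsM; [apply: cts_hrowX; cts|cts].
Qed.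

Lemma near_rest_subproof i (o : near_dom i) : row' i (val (val o)) \in B.
Proof.
apply/mem_set; have [Xz injz] := conf_row' i (set_valP (val o)); split => //.
apply: (room_neq cs) => //; apply: le_lt_trans (set_valP o).
by rewrite mulr_ge0// (cone_ge0 cs)//; exact: confX_X.
Qed.

Definition near_rest i (o : near_dom i) : B := SigSub (near_rest_subproof o).

Definition near_coord i (o : near_dom i) : B * I :=
  (near_rest o, clamp (1 - h (row i (val (val o))) * 2 / room h (val (near_rest o)))).

Lemma near_coord_continuous i : continuous (@near_coord i).
Proof.
have crest : continuous (@near_rest i).
  by apply: cts_sub => /=; apply: cts_row'; cts.
apply: cts_pair => //; apply: cts_clamp; apply: ctsD; first by cts.
apply: ctsN; apply: ctsM.
  by apply: ctsM; [apply: cts_hrowX; cts|cts].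
apply: ctsV; first by move=> o; rewrite gt_eqF// room_pos.
by apply: cts_roomX; cts.
Qed.

(** Separates the coordinates that extend continuously to height 0, namely [near_coord], from the
    direction [p], which does not; [tube] controls the latter uniformly. *)
Lemma spread_near i (o : near_dom i) :
  (h (row i (val (val o))) = 0 -> spread (val o) = be i (near_rest o)) /\
  (0 < h (row i (val (val o))) -> exists j (p : L j),
    spread (val o) = ep i j ((near_coord o).1, p, (near_coord o).2)).
Proof.
split=> hi.
  rewrite -spread_x; congr spread; apply: val_inj.
  by rewrite /= -[LHS](insert_row' i) (cone_eq0 cs (confX_X _ _) hi).
have oA : val (val o) \in A.
  have [Xz injz] := set_valP (val o); apply/mem_set; split => // l; split => //.
  case: (unliftP i l) => [a ->|->]; last exact: (cone_gt0_neq cs hi).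
  by rewrite -row_row'; have [] := confB_Xx (near_rest o) a.
pose a : A := SigSub oA.
have -> : val o = inclA a by exact: val_inj.
rewrite spread_incl.
have r0 := room_pos (near_rest o); have or' := set_valP o.
have a1 : h (row i (val a)) < room h (row' i (val a)).
  by apply: le_lt_trans or'; rewrite /=; lra.
have [j Lj] := piece_cover ls (radial_link a1).
pose q : chart_dom i j := SigSub (mem_set (conj a1 Lj)).
have -> : a = insA i (chart q) by rewrite chartK.
exists j, (chart q).1.2; rewrite [chart q]surjective_pairing push_seam.
  have -> : (near_coord o).1 = (chart q).1.1 by exact: val_inj.
  by rewrite -surjective_pairing.
by rewrite /= ler_pdivrMr// mul1r ltW.
Qed.

Lemma spread_continuous : continuous spread.
Proof.
move=> z; have [zx|/existsNP [i /negP]] :=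
    pselect (forall i, 0 < h (row i (val z))).
- pose D : set FX := [set z | forall i, 0 < h (row i (val z))].
  have oD : open D.
    rewrite openE => y yD; pose P i : set FX := [set y | 0 < h (row i (val y))].
    apply: (@filter_forall FX 'I_n.+1 P (nbhs y)) => i; apply: open_nbhs_nbhs; split; last exact: yD.
    by apply: open_lt_cts; [cts|apply: cts_hrowX; cts].
  apply: (@cts_at_open _ _ spread D) => //.
  have oA (o : D) : val (val o) \in A.
    have [Xz injz] := set_valP (val o); apply/mem_set; split => // l; split => //.
    exact/(cone_gt0_neq cs)/(set_valP o).
  apply: (@cts_eq _ _ (fun o : D => push (SigSub (oA o) : A, unit1))).
    by move=> o; rewrite -spread_incl; congr spread; exact: val_inj.
  apply: (cts_comp push_continuous); apply: cts_pair; last by cts.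
  by apply: cts_sub; rewrite /=; cts.
- rewrite -leNgt => zi.
  have {}zi : h (row i (val z)) = 0.
    by apply/eqP; rewrite eq_le zi (cone_ge0 cs)//; exact: confX_X.
  have zx := cone_eq0 cs (confX_X z i) zi.
  have zD : near_dom i z.
    rewrite /near_dom /= zi mul0r; apply: (room_gt0 cs) => l.
    rewrite row_row'; split; first exact: confX_X.
    move=> lx; have [_ injz] := set_valP z; have /injz/eqP := etrans lx (esym zx).
    by rewrite eq_sym (negbTE (neq_lift _ _)).
  pose o0 : near_dom i := SigSub (mem_set zD).
  suff cso : {for o0, continuous (fun o : near_dom i => spread (val o))}.
    exact: (cts_at_open_pt (near_dom_open i) cso).
  move=> W; rewrite /= (proj1 (spread_near o0) zi) => nW.
  have coord0 : near_coord o0 = (near_rest o0, unit1).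
    by rewrite /near_coord [val o0]/= zi mul0r mul0r subr0 clamp1.
  have := @near_coord_continuous i o0; rewrite /continuous_at coord0 => nc.
  (* Nearby configurations are of two kinds: [W1] serves those whose [i]-th point has left [x],
     whatever its direction, and [W2] those whose [i]-th point is still at [x]. *)
  have W1 : \forall o \near o0, forall j (p : L j),
      W (ep i j ((near_coord o).1, p, (near_coord o).2)) by exact: nc _ (tube nW).
  have crest : continuous (@near_rest i).
    by apply: cts_sub => /=; apply: cts_row'; cts.
  have W2 : \forall o \near o0, W (be i (near_rest o)).
    exact: (crest o0 _ (cyl_be_continuous cyl i _ _ nW)).
  suff : \forall o \near o0, W (spread (val o)) by [].
  refine (@filterS _ (nbhs o0) _ _ _ _ (filterI W1 W2)) => o [W1o W2o].
  have [se sp] := spread_near o; have [hi|hi] := eqVneq (h (row i (val (val o)))) 0.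
    by rewrite se.
  have [|j [p ->]] := sp; last exact: W1o.
  by rewrite lt_neqAle eq_sym hi (cone_ge0 cs)//; exact: confX_X.
Qed.

Lemma double_cylinder_conf : homotopy_equivalent R T FX.
Proof.
have [||i j|i j y|i j y|F [cF Fal Fbe Fep]] :=
    @cyl_map _ _ _ _ _ _ _ _ _ _ _ cyl FX inclA insx (@insF).
- exact: inclA_continuous.
- exact: insx_continuous.
- exact: insF_continuous.
- by apply: val_inj; rewrite /= subr0.
- by apply: val_inj; rewrite /= subrr /radius !mul0r homothety0.
have spreadK z : F (spread z) = z.
  rewrite /spread; case: cid => t /= [[a az ->]|[i [b [zb ->]]]]; last first.
    by rewrite Fbe; apply: val_inj; exact/esym.
  have -> : z = inclA a by exact/val_inj/esym.
  have [af|[i [j aij]]] := far_or_chart a; first by rewrite push_far// Fal.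
  pose o : chart_dom i j := SigSub (mem_set aij).
  have -> : a = insA i (chart o) by rewrite chartK.
  move: (chart o) => [y v]; have [v1|v1] := leP (val v) 1.
    rewrite push_seam// Fep; apply: val_inj; congr (ins i (homothety x (radius _ _) _) _).
    rewrite val_clamp ?subKr// ?subr_ge0// gerBl.
    by have /andP[/ltW] := val_V v.
  by rewrite push_insA /fold ifT ?Fal// subr_le0 ltW.
exists F, spread; split => //; first exact: spread_continuous.
(* On [A] the homotopy runs [push] backwards, from the section to the identity; on the edges and the
   copies of [B] it is constant. The prescriptions agree because [push] fixes the seam. *)
- have [||i j|i j y s|i j y s|K [cK Kal Kbe Kep]] :=
    @cyl_universal _ _ _ _ _ _ _ _ _ _ _ cyl T
      (fun z => push (z.1, clamp (1 - val z.2))) (fun i z => be i z.1)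
      (fun i j z => ep i j z.1).
  + by apply: (cts_comp push_continuous); cts.
  + by move=> i; apply: (cts_comp (cyl_be_continuous cyl i)); cts.
  + by apply: (cts_comp (cyl_ep_continuous cyl i j)); cts.
  + by rewrite (cyl_ep0 cyl) /= push_phi1.
  + by rewrite (cyl_ep1 cyl).
  exists K; split => // t; have [[a ->]|[i [b ->]]|[i [j [y [s ->]]]]] := cyl_cover cyl t.
  + by rewrite Kal /= subr0 clamp1 Fal spread_incl.
  + by rewrite Kbe /= Fbe spread_x.
  + rewrite Kep /= Fep; have [s1|s1] := eqVneq s unit1.
      subst s; rewrite (cyl_ep1 cyl) -spread_x; congr spread; apply: val_inj.
      by rewrite /= subrr /radius !mul0r homothety0.
    have v_in : 1 - val s \in V.
      apply/mem_set; rewrite /= in_itv /= subr_gt0; apply/andP; split.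
        rewrite lt_neqAle val_unit_le1 andbT; apply: contra_neq s1 => /= s1.
        exact: val_inj.
      by have := val_unit_ge0 s; rewrite /=; lra.
    have -> : insF i (y, s) = inclA (insA i (y, SigSub v_in)) by exact: val_inj.
    rewrite spread_incl push_seam /=; last by rewrite gerBl; exact: val_unit_ge0.
    by rewrite subKr clampK.
  + by rewrite Kal /= subrr clamp0 push0.
  + by rewrite Kbe.
  + by rewrite Kep.
(* The section is strict, so a constant homotopy suffices. *)
- exists fst; split => [|z|//]; first by cts.
  by rewrite /= spreadK.
Qed.

End retraction.

End near_center.

(** * Pushing configurations out of the star *)

Section push_out.
Context {R : realType} {d : nat} {X : set 'rV[R]_d} {x : 'rV[R]_d}.
Context {h : 'rV[R]_d -> R} {Lk : set 'rV[R]_d}.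
Hypothesis cs : cone_structure X x h Lk.
Hypothesis closedX : closed X.
Local Notation I := (unit_interval R).

Lemma closed_sublevel e : closed [set y | X y /\ h y <= e].
Proof.
have /continuous_closedP/(_ _ (@closed_le R e)) := cone_within cs.
move=> /closed_subspaceP[V cV VX].
rewrite (_ : [set _ | _] = V `&` X); first exact: closedI.
by rewrite VX; apply/seteqP; split => y /= [].
Qed.

Lemma open_star_sub e y : 0 < e <= 1 -> open_star x Lk e y -> X y /\ h y < e.
Proof.
move=> /andP[e0 e1] [->|[[p s] [/= Lp] /=]].
  by rewrite (cone_center0 cs); split => //; exact: cone_center cs.
rewrite in_itv /= => /andP[s0 s1] <-; rewrite cone_pointE.
have [|Xp ->] := cone_link cs Lp (c := e * s).
  by rewrite mulr_ge0 ?(ltW e0)//= mulr_ile1// ltW.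
by split => //; rewrite gtr_pMr.
Qed.

Lemma sub_open_star e y : 0 < e <= 1 -> X y -> h y < e -> open_star x Lk e y.
Proof.
move=> /andP[e0 e1] Xy hy; have [yx|/eqP yx] := eqVneq y x; [by left|right].
have h0 := cone_gt0 cs Xy yx.
exists (homothety x (h y)^-1 y, h y / e) => /=.
  split; first by apply: (cone_radial cs) => //; rewrite h0 (lt_le_trans hy).
  by rewrite /= in_itv /= divr_ge0 ?(ltW e0) ?(ltW h0)//= ltr_pdivrMr// mul1r.
by rewrite cone_pointE homothetyM mulrCA divff ?gt_eqF// mulr1 divff ?gt_eqF// homothety1.
Qed.

(** A point of height exactly [e < 1] can be scaled towards [x], hence is a limit of points of the
    open star. For [e = 1] this argument breaks down, since the height is 1 also far from the
    star. *)
Lemma outside_star_gt e y : 0 < e < 1 ->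
  (X `\` closure (open_star x Lk e)) y <-> X y /\ e < h y.
Proof.
move=> /andP[e0 e1]; have e01 : 0 < e <= 1 by rewrite e0 ltW.
split=> [[Xy yU]|[Xy hy]]; split => //.
  rewrite ltNge; apply/negP => hy; apply: yU.
  have [{}hy|hy'] := ltP (h y) e; first exact/subset_closure/sub_open_star.
  have {hy hy'} hy : h y = e by apply/eqP; rewrite eq_le hy.
  move=> W nW; have ch : continuous (fun c : R => homothety x c y).
    by apply: cts_homothety; cts.
  have /nbhs_ballP[eps /= eps0 sub] : nbhs (1 : R) [set c | W (homothety x c y)].
    by apply: ch; rewrite homothety1.
  (* A factor below 1 within [eps] of it; the cut-off at 0 keeps it nonnegative. *)
  pose c := Num.max 0 (1 - eps / 2).
  have c0 : 0 <= c by rewrite le_max lexx.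
  have c1 : c < 1 by rewrite gt_max ltr01 /=; lra.
  exists (homothety x c y); split; last first.
    apply: sub; rewrite /ball /= ger0_norm; last by rewrite subr_ge0 ltW.
    by rewrite ltrBlDr -ltrBlDl lt_max; apply/orP; right; lra.
  have [|//||Xc hc] := cone_scale cs Xy (c := c); first by rewrite hy.
    by rewrite hy mulr_ile1// ltW.
  by apply: sub_open_star => //; rewrite hc hy gtr_pMl.
move=> yU; suff [_] : [set y | X y /\ h y <= e] y by rewrite leNgt hy.
have -> : [set y | X y /\ h y <= e] = closure [set y | X y /\ h y <= e].
  by apply/closure_id; exact: closed_sublevel.
by apply: closure_subset yU => z /(open_star_sub e01)[Xz /ltW].
Qed.

Lemma outside_star_gt34 e y : 0 < e <= 1 ->
  (X `\` closure (open_star x Lk e)) y -> e * (3 / 4) < h y.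
Proof.
move=> e01 [Xy yU]; rewrite ltNge; apply/negP => hy; apply: yU.
apply/subset_closure/sub_open_star => //; apply: le_lt_trans hy _.
by case/andP: e01 => *; lra.
Qed.

(** The factor is chosen so that the height [h] becomes [h + l(1 - h)]. Points of height 1 are
    fixed, so the map extends continuously beyond the star. *)
Definition push_out (l : R) (y : 'rV[R]_d) : 'rV[R]_d :=
  homothety x (1 + l * ((1 - h y) / h y)) y.

Lemma push_outE l y : 0 <= l <= 1 -> X y -> y <> x ->
  X (push_out l y) /\ h (push_out l y) = h y + l * (1 - h y).
Proof.
move=> /andP[l0 l1] Xy yx; have h0 := cone_gt0 cs Xy yx.
have h1 := cone_le1 cs Xy.
have ch : (1 + l * ((1 - h y) / h y)) * h y = h y + l * (1 - h y).
  by rewrite mulrDl mul1r -mulrA divfK// gt_eqF.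
rewrite /push_out; move: h1; rewrite le_eqVlt => /predU1P[h1|h1].
  by rewrite h1 subrr mul0r !mulr0 !addr0 homothety1.
rewrite -ch; apply: (cone_scale cs) => //.
  by rewrite addr_ge0// mulr_ge0// divr_ge0 ?(ltW h0)// subr_ge0 ltW.
by rewrite ch; nra.
Qed.

(** For [l < 1] the new height is strictly increasing in the old one, so the heights agree; the two
    points are then scaled by the same nonzero factor. *)
Lemma push_out_inj l y z : 0 <= l < 1 -> X y -> y <> x -> X z -> z <> x ->
  push_out l y = push_out l z -> y = z.
Proof.
move=> /andP[l0 l1] Xy yx Xz zx e; have l01 : 0 <= l <= 1 by rewrite l0 ltW.
have [_ hy] := push_outE l01 Xy yx; have [_ hz] := push_outE l01 Xz zx.
have hyz : h y = h z by have := congr1 h e; rewrite hy hz; nra.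
have h0 := cone_gt0 cs Xy yx; have h1 := cone_le1 cs Xy.
have c0 : 1 + l * ((1 - h y) / h y) != 0.
  by rewrite gt_eqF// ltr_wpDr// mulr_ge0// divr_ge0 ?(ltW h0)// subr_ge0.
move: e; rewrite /push_out -hyz => /(congr1 (homothety x (1 + l * ((1 - h y) / h y))^-1)).
by rewrite !homothetyM mulVf// !homothety1.
Qed.

Lemma push_out0 y : push_out 0 y = y.
Proof. by rewrite /push_out mul0r addr0 homothety1. Qed.

Section configurations.
Context {m : nat}.

Definition push_conf (l : R) (c : 'M[R]_(m, d)) : 'M[R]_(m, d) := \matrix_a push_out l (row a c).

Lemma row_push_conf l c a : row a (push_conf l c) = push_out l (row a c).
Proof. by rewrite rowK. Qed.

Lemma push_conf0 c : push_conf 0 c = c.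
Proof. by apply/row_matrixP => a; rewrite row_push_conf push_out0. Qed.

Lemma conf_push l (c : 'M[R]_(m, d)) (Y : set 'rV[R]_d) : 0 <= l < 1 -> conf m (X `\ x) c ->
  (forall y, X y -> y <> x -> h y + l * (1 - h y) <= h (push_out l y) -> Y (push_out l y)) ->
  conf m Y (push_conf l c).
Proof.
move=> l01 [Xc injc] XY; have l01' : 0 <= l <= 1 by case/andP: l01 => -> /ltW.
split=> [a|a b]; rewrite !row_push_conf.
  by have [Xa ax] := Xc a; apply: XY => //; have [_ ->] := push_outE l01' Xa ax.
by have [[Xa ax] [Xb bx]] := (Xc a, Xc b) => /(push_out_inj l01 Xa ax Xb bx) /injc.
Qed.

Lemma cts_push_conf (S : topologicalType) (l : S -> R) (c : S -> 'M[R]_(m, d)) :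
  continuous l -> continuous c -> (forall s, conf m (X `\ x) (c s)) ->
  continuous (fun s => push_conf (l s) (c s)).
Proof.
move=> cl cc Xc; apply: cts_mx => a v.
have Xa s : X (row a (c s)) by have [/(_ a) []] := Xc s.
have ha s : 0 < h (row a (c s)).
  by have [/(_ a) [_ ax] _] := Xc s; exact: (cone_gt0 cs).
have ch : continuous (fun s => h (row a (c s))).
  by apply: (cone_continuous cs) => //; exact: cts_row.
have cca : continuous (fun s => row a (c s)) by exact: cts_row.
apply: (@cts_eq _ _ (fun s => push_out (l s) (row a (c s)) 0 v)).
  by move=> s; rewrite [in RHS]mxE.
apply: cts_coord; apply: cts_homothety => //; apply: ctsD; first by cts.
apply: ctsM => //; apply: ctsM; first by cts.
by apply: ctsV => // s; rewrite gt_eqF.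
Qed.

Lemma conf_outside_equivalence e : 0 < e < 1 ->
  exists r : conf m (X `\ x) -> conf m (X `\` closure (open_star x Lk e)),
    homotopy_inverse R (conf_outside_incl m X Lk x e) r.
Proof.
move=> e01; have /andP[e0 e1] := e01; have e01' : 0 <= e < 1 by rewrite ltW.
(* With [l = e] the new height is [e + h(1 - e)], which exceeds [e] as soon as [h > 0]. Both
   homotopies let [l] decrease from [e] to 0. *)
have rP (c : conf m (X `\ x)) :
    push_conf e (val c) \in conf m (X `\` closure (open_star x Lk e)).
  apply/mem_set/conf_push => //; first exact: set_valP.
  move=> y Xy yx hy; apply/outside_star_gt => //.
  have [|Xp _] := @push_outE e y _ Xy yx; first by rewrite !ltW.
  by split => //; apply: lt_le_trans hy; have := cone_gt0 cs Xy yx; nra.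
have se (s : I) : 0 <= (1 - val s) * e < 1.
  have := val_unit_ge0 s; have := val_unit_le1 s; move: (val s : R) => t t1 t0.
  by apply/andP; split; nra.
have inXx (c : conf m (X `\` closure (open_star x Lk e))) : conf m (X `\ x) (val c).
  exact: (conf_subset (@outside_star_subset _ _ _ _ _ _) (set_valP c)).
exists (fun c => SigSub (rP c)); split.
- by apply: cts_sub => /=; cts.
- apply: cts_sub; apply: cts_push_conf; [by cts|by cts|move=> c; exact: set_valP].
- have HP (z : conf m (X `\` closure (open_star x Lk e)) * I) :
      push_conf ((1 - val z.2) * e) (val z.1) \in conf m (X `\` closure (open_star x Lk e)).
    have /andP[l0 l1] := se z.2; have l01 : 0 <= (1 - val z.2) * e <= 1 by rewrite l0 ltW.
    have [Yc injc] := set_valP z.1.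
    apply/mem_set; split=> [a|a b]; rewrite !row_push_conf.
      have [Xa ha] := (outside_star_gt (row a (val z.1)) e01).1 (Yc a).
      have ax : row a (val z.1) <> x by apply: (cone_gt0_neq cs); exact: lt_trans ha.
      have [Xp hp] := push_outE l01 Xa ax.
      apply/outside_star_gt => //; split => //; rewrite hp.
      apply: lt_le_trans ha _.
      by rewrite lerDl mulr_ge0// subr_ge0 (cone_le1 cs).
    have [Xc _] := inXx z.1; have [[Xa ax] [Xb bx]] := (Xc a, Xc b).
    by move=> /(push_out_inj (se z.2) Xa ax Xb bx) /injc.
  exists (fun z => SigSub (HP z)); split.
  + apply: cts_sub; apply: cts_push_conf; [by cts|by cts|move=> z; exact: inXx].
  + by move=> c; apply: val_inj; rewrite /= subr0 mul1r.
  + by move=> c; apply: val_inj; rewrite /= subrr mul0r push_conf0.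
- have HP (z : conf m (X `\ x) * I) :
      push_conf ((1 - val z.2) * e) (val z.1) \in conf m (X `\ x).
    apply/mem_set/conf_push; [exact: se|exact: set_valP|move=> y Xy yx hy].
    have /andP[l0 l1] := se z.2.
    have [|Xp hp] := @push_outE ((1 - val z.2) * e) y _ Xy yx; first by rewrite l0 ltW.
    split => //; apply: (cone_gt0_neq cs); rewrite hp.
    by rewrite ltr_pwDl ?(cone_gt0 cs)// mulr_ge0// subr_ge0 (cone_le1 cs).
  exists (fun z => SigSub (HP z)); split.
  + apply: cts_sub; apply: cts_push_conf; [by cts|by cts|move=> z; exact: set_valP].
  + by move=> c; apply: val_inj; rewrite /= subr0 mul1r.
  + by move=> c; apply: val_inj; rewrite /= subrr mul0r push_conf0.
Qed.

End configurations.

End push_out.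

(** * Realizations of simplicial complexes *)

Definition face_closed (V : finType) (K : {set {set V}}) : Prop :=
  forall s t : {set V}, s \in K -> t \subset s -> t != finset.set0 -> t \in K.

Section realization.
Context {R : realType}.

Lemma supp_neq0 d (y : 'rV[R]_d) : \sum_v y 0 v = 1 -> supp y != finset.set0.
Proof.
move=> y1; apply: contra_eq_neq y1 => y0.
rewrite big1 1?eq_sym ?oner_eq0// => v _; apply/eqP.
by have := finset.in_set0 v; rewrite -y0 inE => /negbFE.
Qed.

Lemma cts_sum (S : topologicalType) (I : Type) (r : seq I) (f : I -> S -> R) :
  (forall i, continuous (f i)) -> continuous (fun s => \sum_(i <- r) f i s).
Proof.
move=> cf; elim: r => [|i r IH].
  by under eq_fun do rewrite big_nil; exact: cts_cst.
by under eq_fun do rewrite big_cons; exact: ctsD.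
Qed.

Definition face d (s : {set 'I_d}) : set 'rV[R]_d :=
  [set y : 'rV[R]_d | [/\ forall v, 0 <= y 0 v, \sum_v y 0 v = 1 & supp y \subset s]].

Lemma closed_face d (s : {set 'I_d}) : closed (face s).
Proof.
have cc v : continuous (fun y : 'rV[R]_d => y 0 v) by apply: cts_coord; cts.
rewrite (_ : face s = (\bigcap_(v in [set: 'I_d]) [set y : 'rV[R]_d | 0 <= y 0 v]) `&`
  ([set y : 'rV[R]_d | \sum_v y 0 v = 1] `&`
   \bigcap_(v in [set v | v \notin s]) [set y : 'rV[R]_d | y 0 v = 0])).
  apply: closedI; last apply: closedI.
  - apply: closed_bigI => v _.
    by apply: (closed_comp _ (@closed_ge R 0)) => y _; exact: cc.
  - apply: (closed_comp _ (@closed_eq R 1)) => y _.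
    by move: y; apply: cts_sum.
  - apply: closed_bigI => v _.
    by apply: (closed_comp _ (@closed_eq R 0)) => y _; exact: cc.
apply/seteqP; split => y.
  move=> [y0 y1 ys]; split => [v _|]; [exact: y0|split => // v /= vs].
  apply/eqP; apply: contraNT vs => yv; apply: (fintype.subsetP ys).
  by rewrite inE.
move=> [y0 [y1 ys]]; split => // [v|]; first exact: y0.
apply/fintype.subsetP => v; rewrite inE; apply: contraNT => vs; apply/eqP.
exact: ys.
Qed.

(** A finite union of closed faces inside the unit cube. *)
Lemma realization_compact d (K : {set {set 'I_d}}) :
  face_closed K -> compact (realization K : set 'rV[R]_d).
Proof.
move=> Kc; have cube : compact [set y : 'rV[R]_d | forall v, y 0 v \in `[0, 1]].
  have := @rV_compact R d (fun=> `[0, 1]%classic) (fun=> @segment_compact R 0 1).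
  by [].
apply: (subclosed_compact _ cube); last first.
  move=> y [y0 y1 _] v; rewrite in_itv /= y0 /= -y1 (bigD1 v)//= lerDl.
  by rewrite sumr_ge0.
rewrite (_ : realization K = \bigcup_(s in [set` K]) face s).
  by apply: closed_bigcup => // s _; exact: closed_face.
apply/seteqP; split => y.
  by move=> [y0 y1 yK]; exists (supp y).
move=> [s sK [y0 y1 ys]]; split => //.
by apply: Kc sK ys _; exact: supp_neq0.
Qed.

Lemma link_face_closed m (K : {set {set 'I_m}}) w :
  face_closed K -> face_closed (link K w).
Proof.
move=> Kc s t; rewrite !inE => /and3P[sK ws wsK] ts t0.
apply/and3P; split; first exact: Kc ts t0.
  by apply: contra ws; exact: fintype.subsetP.
apply: Kc wsK _ _; first exact: finset.setUS.
by apply/finset.set0Pn; exists w; rewrite !inE eqxx.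
Qed.

End realization.

(** * The cone structure at a vertex of a subdivision *)

Section subdivision.
Context {R : realType} {d : nat} {K : {set {set 'I_d}}}.
Context {m : nat} {K' : {set {set 'I_m}}} {P : 'M[R]_(m, d)} {w : 'I_m}.
Local Notation X := (realization K : set 'rV[R]_d).
Hypothesis K'c : face_closed K'.
Hypothesis bijP : set_bij (realization K') X (fun y => y *m P).
Hypothesis wK' : finset.set1 w \in K'.
Local Notation x := (row w P).
Local Notation Lk := (link_space K' P w).

Lemma cts_mulmx (S : topologicalType) (z : S -> 'rV[R]_m) :
  continuous z -> continuous (fun s => z s *m P).
Proof.
move=> cz; apply: cts_mx => i j; under eq_fun do rewrite mxE.
apply: cts_sum => l; apply: ctsM; last by cts.
exact: cts_coord.
Qed.

(** One minus the barycentric coordinate at [w] in the subdivision; the default 0 of [xget] is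
    reached only outside [X]. *)
Definition star_height (y : 'rV[R]_d) : R :=
  1 - (xget 0 [set z | realization K' z /\ z *m P = y]) 0 w.

Lemma star_heightE z : realization K' z -> star_height (z *m P) = 1 - z 0 w.
Proof.
move=> Kz; rewrite /star_height (@xget_unique _ _ _ z)// => u [Ku uz].
by have [_ inj _] := bijP; apply: inj => //; exact/mem_set.
Qed.

Lemma realization_coord y : X y -> exists2 z, realization K' z & y = z *m P.
Proof. by have [_ _ surj] := bijP => /surj [z Kz <-]; exists z. Qed.

Lemma realization_mul z : realization K' z -> X (z *m P).
Proof. by have [maps _ _] := bijP; exact: maps. Qed.

Definition mix (c : R) (z : 'rV[R]_m) : 'rV[R]_m := homothety (delta_mx 0 w) c z.

Lemma mixE c z v : mix c z 0 v = (1 - c) * (v == w)%:R + c * z 0 v.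
Proof. by rewrite !mxE eqxx /=; ring. Qed.

Lemma mix_mul c z : mix c z *m P = homothety x c (z *m P).
Proof. by rewrite /mix /homothety mulmxDl -scalemxAl mulmxBl -rowE. Qed.

(** The factor [c] may exceed 1, moving [z] away from [w]. The bound on [c] says exactly that the
    coordinate at [w], now [1 - c(1 - z_w)], stays nonnegative. *)
Lemma mix_realization c z : realization K' z -> (w |: supp z)%SET \in K' ->
  0 <= c -> c * (1 - z 0 w) <= 1 -> realization K' (mix c z).
Proof.
move=> [z0 z1 _] wz c0 cz.
have sum1 : \sum_v mix c z 0 v = 1.
  under eq_bigr do rewrite mixE.
  rewrite big_split /= -!mulr_sumr z1 mulr1 (bigD1 w)//= eqxx big1 ?addr0.
    by rewrite mulr1 subrK.
  by move=> v /negbTE ->.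
split=> [v|//|].
  rewrite mixE; case: eqVneq => [->|_] /=; first by rewrite mulr1; lra.
  by rewrite mulr0 add0r mulr_ge0.
apply: (K'c wz); last exact: supp_neq0.
apply/fintype.subsetP => v; rewrite !inE mixE; case: (eqVneq v w) => //= _.
by rewrite mulr0 add0r; apply: contra_neq => ->; rewrite mulr0.
Qed.

Lemma delta_realization : realization K' (delta_mx 0 w : 'rV[R]_m).
Proof.
split=> [v||]; first by rewrite mxE ler0n.
  rewrite (bigD1 w)//= big1 ?addr0 ?mxE ?eqxx//.
  by move=> v /negbTE vw; rewrite mxE vw andbF.
rewrite (_ : supp _ = finset.set1 w)//; apply/setP => v.
by rewrite !inE mxE eqxx /= pnatr_eq0 eqb0 negbK.
Qed.

Lemma realization_le1 (z : 'rV[R]_m) : realization K' z -> z 0 w <= 1.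
Proof. by move=> [z0 z1 _]; rewrite -z1 (bigD1 w)//= lerDl sumr_ge0. Qed.

(** A continuous bijection from a compact space to a Hausdorff one has a continuous inverse: the
    preimage of a closed set is the trace on [X] of the image of a compact set. *)
Lemma star_height_continuous : {within X, continuous star_height}.
Proof.
apply/subspace_sigL_continuousP/continuous_closedP => D cD.
have -> : sigL X star_height @^-1` D =
    val @^-1` ((fun z => z *m P) @` (realization K' `&` [set z | D (1 - z 0 w)])).
  apply/seteqP; split=> y.
    rewrite /sigL /= => Dy; have [z Kz yz] := realization_coord (set_valP y).
    exists z; last by rewrite -yz.
    by split => //=; rewrite -star_heightE// -yz.
  move=> [z [Kz Dz] zy]; change (D (star_height (val y))).
  by have <- : z *m P = val y by []; rewrite star_heightE.
apply: closed_comp; first by move=> y _; exact: cts_val_incl.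
apply: compact_closed; first exact: norm_hausdorff.
apply: continuous_compact; first by apply/continuous_subspaceT/cts_mulmx; cts.
apply: compact_closedI; first exact: realization_compact.
apply: closed_comp cD => z _; move: z; apply: ctsD; first by cts.
by apply: ctsN; apply: cts_coord; cts.
Qed.

Lemma link_coord p : Lk p ->
  exists z, [/\ realization K' z, z 0 w = 0, (w |: supp z)%SET \in K' & z *m P = p].
Proof.
move=> [z [z0 z1]]; rewrite !inE negbK => /and3P[zK /eqP zw wz] zp.
by exists z.
Qed.

Lemma realization_cone : cone_structure X x star_height Lk.
Proof.
have xE : x = delta_mx 0 w *m P by rewrite rowE.
split.
- by rewrite xE; exact/realization_mul/delta_realization.
- move=> _ /realization_coord[z Kz ->].
  by rewrite star_heightE// subr_ge0 realization_le1.
- move=> _ /realization_coord[z Kz ->]; rewrite star_heightE// gerBl.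
  by have [] := Kz.
- by rewrite xE star_heightE ?mxE ?eqxx ?subrr//; exact: delta_realization.
- move=> _ /realization_coord[z Kz ->]; rewrite star_heightE// => /subr0_eq z1.
  rewrite xE; congr (_ *m P); apply/rowP => v; rewrite mxE eqxx /=.
  have [->|vw] := eqVneq v w; first by rewrite -z1.
  have [z0 sz _] := Kz; apply: le_anti; rewrite z0 andbT.
  have : z 0 v <= \sum_(u | u != w) z 0 u by rewrite (bigD1 v)//= lerDl sumr_ge0.
  by move: sz; rewrite (bigD1 w)//= -z1 => /(canRL (addKr _)) ->; rewrite addNr.
- exact: star_height_continuous.
- move=> _ c /realization_coord[z Kz ->]; rewrite star_heightE// => zw c0 cz.
  have wz : (w |: supp z)%SET \in K'.
    have [_ _ Ks] := Kz; rewrite (finset.setUidPr _)// finset.sub1set inE.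
    by apply/eqP => zw0; move: zw; rewrite zw0 subr0 ltxx.
  have Km := mix_realization Kz wz c0 cz.
  rewrite -mix_mul star_heightE// mixE eqxx; split; first exact: realization_mul.
  by rewrite mulr1; ring.
- move=> p c /link_coord[z [Kz zw wz <-]] /andP[c0 c1].
  have Km : realization K' (mix c z) by apply: mix_realization; rewrite // zw subr0 mulr1.
  rewrite -mix_mul star_heightE// mixE eqxx zw; split; first exact: realization_mul.
  by rewrite mulr1; ring.
- move=> _ /realization_coord[z Kz ->]; rewrite star_heightE// => /andP[h0 h1].
  have wz : (w |: supp z)%SET = supp z.
    apply/finset.setUidPr; rewrite finset.sub1set inE.
    by apply/eqP => zw0; move: h1; rewrite zw0 subr0 ltxx.
  (* This factor brings the coordinate at [w] to 0: it is where the ray from [w] through [z] meets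
     the link. *)
  have Km : realization K' (mix (1 - z 0 w)^-1 z).
    apply: mix_realization; rewrite ?wz ?invr_ge0 ?(ltW h0)//; first by case: Kz.
    by rewrite mulVf// gt_eqF.
  exists (mix (1 - z 0 w)^-1 z); last by rewrite -mix_mul.
  have mw : mix (1 - z 0 w)^-1 z 0 w = 0.
    have h0' : 1 - z 0 w != 0 by rewrite gt_eqF.
    by rewrite mixE eqxx mulr1; field.
  have [m0 m1 mK] := Km; split => //; rewrite !inE mK mw eqxx /=.
  have [_ _ zK] := Kz; apply: (K'c zK); last first.
    by apply/finset.set0Pn; exists w; rewrite !inE eqxx.
  rewrite -wz; apply: finset.setUS.
  apply/fintype.subsetP => v; rewrite !inE mixE; case: (eqVneq v w) => [->|_].
    by move=> _; move/finset.setUidPr: wz; rewrite finset.sub1set inE.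
  by rewrite mulr0 add0r; apply: contra_neq => ->; rewrite mulr0.
Qed.

Lemma link_compact : compact Lk.
Proof.
apply: continuous_compact; first by apply/continuous_subspaceT/cts_mulmx; cts.
exact/realization_compact/link_face_closed.
Qed.

End subdivision.

Arguments star_height {R d m} K' P w y.

(** Components are closed in the compact link. There are only [k] of them, so each is cut out of
    [Lk] by the open complement of the union of the others. *)
Lemma components_pieces (R : realType) (d : nat) (Lk : set 'rV[R]_d) (k : nat)
    (L : 'I_k -> set 'rV[R]_d) :
  compact Lk -> set_bij [set: 'I_k] (components Lk) L -> link_pieces Lk L.
Proof.
move=> cLk [LC Linj Lsurj].
have closedLk : closed Lk by apply: compact_closed => //; exact: norm_hausdorff.
have LE j p : L j p -> L j = connected_component Lk p.
  have [q Lq Lj] := LC j I; rewrite -Lj => qp; exact: same_connected_component.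
have Lcl j : closed (L j).
  by have [q _ <-] := LC j I; exact: component_closed.
have Lsub j : L j `<=` Lk.
  by have [q _ <-] := LC j I; exact: connected_component_sub.
have Ldisj j j' p : L j p -> L j' p -> j = j'.
  move=> jp j'p; apply: Linj; rewrite ?inE//.
  by rewrite (LE _ _ jp) (LE _ _ j'p).
have Lcov p : Lk p -> exists j, L j p.
  move=> Lp; have [|j _ jE] := Lsurj (connected_component Lk p); first by exists p.
  by exists j; rewrite jE; exact: connected_component_refl.
split => // [j|j]; first exact: subclosed_compact (Lcl j) cLk (Lsub j).
exists (~` \bigcup_(j' in [set j' | j' != j]) L j').
  by apply: closed_openC; apply: closed_bigcup => [|j' _]; [exact: finite_finset|exact: Lcl].
apply/seteqP; split=> [p jp|p [Lp np]].
  split; [exact: Lsub jp|move=> [j' /= /eqP j'j j'p]].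
  by apply: j'j; exact: Ldisj j'p jp.
have [j' j'p] := Lcov p Lp; have [<-//|j'j] := eqVneq j' j.
by case: np; exists j'.
Qed.

(** * Components and their number *)

Section components.

Lemma path_component (R : realType) (T : topologicalType) (g : R -> T) :
  continuous g -> connected_component [set: T] (g 0) (g 1).
Proof.
move=> cg; apply: (@connected_component_max _ _ (g @` `[0, 1]%classic)).
- by exists 0 => //; rewrite /= in_itv /= lexx ler01.
- exact: subsetT.
- apply: connected_continuous_connected; first exact: segment_connected.
  exact: continuous_subspaceT.
- by exists 1 => //; rewrite /= in_itv /= lexx ler01.
Qed.

Lemma connected_set_type (T : topologicalType) (A : set T) :
  connected A -> connected [set: A].
Proof.
move=> cA U [u Uu] [D oD UD] [D' cD' UD'].
have [E oE ED] : exists2 E : set T, open E & D = val @^-1` E.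
  by have [E oE <-] := oD; exists E.
have [E' cE' ED'] : exists2 E : set T, closed E & D' = val @^-1` E.
  have [E' oE' E'D] := closed_openC cD'.
  exists (~` E'); first exact: open_closedC.
  by rewrite -[LHS]setCK -E'D.
rewrite setTI in UD; rewrite setTI in UD'.
have imE : val @` U = A.
  apply: cA; first by exists (val u), u.
  - exists E => //; apply/seteqP; split=> [_ [y Uy <-]|y [Ay Ey]].
      by split; [exact: set_valP|move: Uy; rewrite UD ED].
    by exists (SigSub (mem_set Ay)) => //; rewrite UD ED.
  - exists E' => //; apply/seteqP; split=> [_ [y Uy <-]|y [Ay Ey]].
      by split; [exact: set_valP|move: Uy; rewrite UD' ED'].
    by exists (SigSub (mem_set Ay)) => //; rewrite UD' ED'.
apply/seteqP; split => // y _; have : (val @` U) (val y) by rewrite imE; exact: set_valP.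
by case=> z Uz /val_inj <-.
Qed.

(** From [(s, t)] one moves within the slice at height [t] to [(s', t)], then along the connected
    fibre over [s']; the converse inclusion is projection. *)
Lemma connected_component_prod (S T : topologicalType) (s : S) (t : T) :
  connected [set: T] ->
  connected_component [set: S * T] (s, t) =
  connected_component [set: S] s `*` [set: T].
Proof.
move=> cT; apply/seteqP; split=> [[s' t'] st|[s' t'] [/= ss' _]].
  split => //=; apply: (@connected_component_max _ _
    (fst @` connected_component [set: S * T] (s, t))).
  - by exists (s, t) => //; exact: connected_component_refl.
  - exact: subsetT.
  - apply: connected_continuous_connected; first exact: component_connected.
    by apply: continuous_subspaceT; exact: cts_fst_proj.
  - by exists (s', t').
have cs't : connected_component [set: S * T] (s, t) (s', t).
  apply: (@connected_component_max _ _
    ((fun s => (s, t)) @` connected_component [set: S] s)).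
  - by exists s => //; exact: connected_component_refl.
  - exact: subsetT.
  - apply: connected_continuous_connected; first exact: component_connected.
    by apply: continuous_subspaceT; cts.
  - by exists s'.
apply: connected_component_trans cs't _.
apply: (@connected_component_max _ _ (pair s' @` [set: T])).
- by exists t.
- exact: subsetT.
- apply: connected_continuous_connected => //.
  by apply: continuous_subspaceT; exact: cts_pairl.
- by exists t'.
Qed.

Lemma pi0_prod (S T : topologicalType) :
  connected [set: T] -> [set: T] !=set0 ->
  pi0 (S * T)%type = [set C `*` [set: T] | C in pi0 S].
Proof.
move=> cT [t _]; apply/seteqP; split=> [_ [[s t'] _ <-]|_ [_ [s _ <-] <-]].
  rewrite connected_component_prod//.
  by exists (connected_component [set: S] s) => //; exists s.
by exists (s, t) => //; rewrite connected_component_prod.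
Qed.

End components.

(** * Finiteness of the components of configuration spaces *)

Section finitely_many_components.
Context {R : realType} {d : nat} (K : {set {set 'I_d}}) (x : 'rV[R]_d) (m : nat).
Local Notation Y := (realization K `\ x).

(* Whether a matrix is a configuration in [Y] depends only on the signs of these
   affine functions; hence configurations with the same signs are joined by a
   segment. *)
Definition sign_test (t : 'I_m * 'I_m * 'I_d + 'I_m * 'I_d + 'I_m * 'I_d)
    (c : 'M[R]_(m, d)) : R :=
  match t with
  | inl (inl (a, b, v)) => c a v - c b v
  | inl (inr (a, v)) => c a v - x 0 v
  | inr (a, v) => c a v
  end.

Definition sign_vector (c : 'M[R]_(m, d)) :
    {ffun 'I_m * 'I_m * 'I_d + 'I_m * 'I_d + 'I_m * 'I_d -> bool * bool} :=
  [ffun t => (0 < sign_test t c, sign_test t c < 0)].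

Definition segment (c c' : 'M[R]_(m, d)) (t : R) := (1 - t) *: c + t *: c'.

Lemma sign_test_segment u c c' t : sign_test u (segment c c' t) =
  (1 - t) * sign_test u c + t * sign_test u c'.
Proof. by case: u => [[[[a b] v]|[a v]]|[a v]] /=; rewrite !mxE; ring. Qed.

Lemma sign_test_eq0 u c c' t : 0 <= t <= 1 -> sign_vector c = sign_vector c' ->
  (sign_test u (segment c c' t) == 0) = (sign_test u c == 0).
Proof.
move=> /andP[t0 t1] /ffunP/(_ u); rewrite !ffunE sign_test_segment => -[].
move: (sign_test u c) (sign_test u c') => p q.
have [p0|p0|->] := ltgtP p 0; have [q0|q0|->] := ltgtP q 0 => // _ _.
- by apply/negbTE; rewrite lt_eqF//; nra.
- by apply/negbTE; rewrite gt_eqF//; nra.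
- by rewrite !mulr0 addr0 eqxx.
Qed.

Lemma segment_conf c c' t : 0 <= t <= 1 -> sign_vector c = sign_vector c' ->
  conf m Y c -> conf m Y c' -> conf m Y (segment c c' t).
Proof.
move=> t01 cc' [Yc injc] [Yc' _]; have /andP[t0 t1] := t01.
split=> [a|a b].
  have [[c0 c1 cK] cx] := Yc a; have [[c'0 c'1 _] _] := Yc' a; split; first split.
  - move=> v; have := c0 v; have := c'0 v; rewrite !mxE => p q.
    by rewrite addr_ge0// mulr_ge0// subr_ge0.
  - transitivity ((1 - t) * \sum_v row a c 0 v + t * \sum_v row a c' 0 v); last first.
      by rewrite c1 c'1; ring.
    rewrite !mulr_sumr -big_split /=.
    by apply: eq_bigr => v _; rewrite !mxE.
  - rewrite (_ : supp _ = supp (row a c))//; apply/setP => v; rewrite !inE ![row _ _ _ _]mxE.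
    by rewrite (sign_test_eq0 (inr (a, v)) t01 cc').
  - move=> /= sx; apply: cx; apply/rowP => v; apply/eqP.
    rewrite mxE -subr_eq0 -(sign_test_eq0 (inl (inr (a, v))) t01 cc') /=.
    by move: sx => /rowP/(_ v); rewrite mxE => ->; rewrite subrr.
move=> ab; apply: injc; apply/rowP => v; apply/eqP.
rewrite !mxE -subr_eq0 -(sign_test_eq0 (inl (inl (a, b, v))) t01 cc') /=.
by move: ab => /rowP/(_ v); rewrite ![row _ _ _ _]mxE => ->; rewrite subrr.
Qed.

Lemma sign_vector_component (c c' : conf m Y) :
  sign_vector (val c) = sign_vector (val c') ->
  connected_component [set: conf m Y] c c'.
Proof.
move=> cc'.
have gP (t : R) : segment (val c) (val c') (val (clamp t)) \in conf m Y.
  apply/mem_set/segment_conf => //; [|exact: set_valP|exact: set_valP].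
  by rewrite val_unit_ge0 val_unit_le1.
pose g t : conf m Y := SigSub (gP t).
have cg : continuous g.
  apply: cts_sub; apply: cts_mx => a v.
  apply: (@cts_eq _ _ (fun t => (1 - val (clamp t)) * val c a v + val (clamp t) * val c' a v)).
    by move=> t; rewrite !mxE.
  by cts.
have -> : c = g 0.
  apply: val_inj; change (val c = segment (val c) (val c') (val (clamp (0 : R)))).
  by rewrite clamp0 val_unit0 /segment subr0 scale1r scale0r addr0.
have -> : c' = g 1.
  apply: val_inj; change (val c' = segment (val c) (val c') (val (clamp (1 : R)))).
  by rewrite clamp1 val_unit1 /segment subrr scale1r scale0r add0r.
exact: path_component.
Qed.

Lemma finite_pi0_conf : finite_set (pi0 (conf m Y)).
Proof.
(* [g s] is a component when some configuration has sign vector [s], and is empty otherwise; hence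
   [pi0] lies in the range of [g], which is finite. *)
pose g s : set (conf m Y) := [set c | exists2 c0 : conf m Y,
  sign_vector (val c0) = s & connected_component [set: conf m Y] c0 c].
apply: (@sub_finite_set _ _ (g @` [set: _])).
  move=> _ [c _ <-]; exists (sign_vector (val c)) => //.
  apply/seteqP; split=> [c1 [c0 /esym c0c]|c1 cc1]; last by exists c.
  by apply: connected_component_trans; exact: sign_vector_component.
apply: finite_image; exact: finite_finset.
Qed.

End finitely_many_components.

(** * Counting vertices and edges *)

Section counting.

Lemma card_bij_fin (T : Type) (F : finType) (f : T -> F) :
  bijective f -> [set: T] #= `I_#|F|.
Proof.
move=> bf; rewrite (card_eqr card_II).
have be : bijective (enum_rank \o f) by apply: bij_comp => //; exact: enum_rank_bij.
have -> : [set: 'I_#|F|] = (enum_rank \o f) @` [set: T].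
  by apply/seteqP; split => // i _; have [g _ gK] := be; exists (g i).
by rewrite card_eq_sym; apply: inj_card_eq => y z _ _; exact: bij_inj.
Qed.

Lemma card_setT_bij (T : Type) (A : set T) n : A #= `I_n ->
  exists f : A -> 'I_n, bijective f.
Proof.
rewrite (card_eqr card_II) => /card_bijP[f [g fK gK]].
pose i (y : 'I_n) : [set: 'I_n] := SigSub (mem_set I : y \in [set: 'I_n]).
exists (fun a => val (f a)); exists (fun y => g (i y)) => y.
  by rewrite -[RHS]fK; congr g; exact: val_inj.
by rewrite gK.
Qed.

(** The informative form allows a bijection and its inverse to be selected for every [j] at once in
    the count of edges. *)
Lemma card_setT_can (T : Type) (A : set T) n : A #= `I_n ->
  {fg : (A -> 'I_n) * ('I_n -> A) | cancel fg.1 fg.2 /\ cancel fg.2 fg.1}.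
Proof.
move=> /card_setT_bij bf; apply: cid; have [f [g fK gK]] := bf.
by exists (f, g).
Qed.

Lemma card_vertices (n a b : nat) (TA TB : Type) (PA : set TA) (PB : set TB) :
  PA #= `I_a -> PB #= `I_b -> [set: PA + 'I_n * PB] #= `I_(a + n * b).
Proof.
move=> /card_setT_bij[f [f' fK f'K]] /card_setT_bij[g [g' gK g'K]].
have -> : (a + n * b = #|{: 'I_a + 'I_n * 'I_b}|)%N.
  by rewrite card_sum card_prod !card_ord.
apply: (@card_bij_fin _ _ (fun v => match v with
  | inl C => inl (f C) | inr (i, C) => inr (i, g C) end)).
exists (fun v => match v with
  | inl C => inl (f' C) | inr (i, C) => inr (i, g' C) end).
  by move=> [C|[i C]]; rewrite ?fK ?gK.
by move=> [C|[i C]]; rewrite ?f'K ?g'K.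
Qed.

Lemma card_edges (n k b : nat) (T : 'I_k -> Type) (P : forall j, set (T j)) :
  (forall j, P j #= `I_b) ->
  [set: {ij : 'I_n * 'I_k & P ij.2}] #= `I_(n * k * b).
Proof.
move=> Pb; pose fg j := sval (card_setT_can (Pb j)).
have fK j : cancel (fg j).1 (fg j).2 by rewrite /fg; case: card_setT_can => ? [].
have gK j : cancel (fg j).2 (fg j).1 by rewrite /fg; case: card_setT_can => ? [].
have -> : (n * k * b = #|{: 'I_n * 'I_k * 'I_b}|)%N by rewrite !card_prod !card_ord.
apply: (@card_bij_fin _ _ (fun e : {ij : 'I_n * 'I_k & P ij.2} =>
  (projT1 e, (fg _).1 (projT2 e)))).
exists (fun e => existT (fun ij : 'I_n * 'I_k => set_type (P ij.2)) e.1 ((fg _).2 e.2)).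
  by move=> [ij C] /=; rewrite fK.
by move=> [ij y] /=; rewrite gK.
Qed.

End counting.

Theorem proposition3p1 (R : realType) (d : nat) (K : {set {set 'I_d}})
    (n k : nat) (x : 'rV[R]_d)
    (m : nat) (K' : {set {set 'I_m}}) (P : 'M[R]_(m, d)) (w : 'I_m)
    (L : 'I_k -> set 'rV[R]_d) :
  let X := realization K in
  let Xx := X `\ x in
  let Lk := link_space K' P w in
  simplicial_complex K ->
  connected X ->
  (exists2 s, s \in K & (2 <= #|s|)%N) ->
  (2 <= n)%N ->
  X x ->
  subdivision K K' P ->
  finset.set1 w \in K' ->
  row w P = x ->
  set_bij [set: 'I_k] (components Lk) L ->
  (forall e : R, 0 < e < 1 ->
     exists r : conf n.-1 Xx -> conf n.-1 (X `\` closure (open_star x Lk e)),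
       homotopy_inverse R (conf_outside_incl n.-1 X Lk x e) r) /\
  (forall j, pi0 (conf n.-1 Xx * L j)%type =
     [set C `*` [set: L j] | C in pi0 (conf n.-1 Xx)]) /\
  (forall (e : R)
     (r : conf n.-1 Xx -> conf n.-1 (X `\` closure (open_star x Lk e))),
     0 < e <= 1 ->
     homotopy_inverse R (conf_outside_incl n.-1 X Lk x e) r ->
     exists (phi : forall (i : 'I_n) (j : 'I_k),
               conf n.-1 Xx * L j -> conf n Xx)
            (phiC : forall i j, continuous (phi i j)),
       [/\ forall i j (c : conf n.-1 Xx) (p : L j),
             val (phi i j (c, p)) =
             insert_point i (cone_point x e (val p) (3 / 4)) (val (r c)),
           homotopy_equivalent R (conf n X)
             (total_space R (distribution_graph phiC))
         & exists a b : nat,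
             [/\ [set: pi0 (conf n Xx)] #= `I_a,
                 [set: pi0 (conf n.-1 Xx)] #= `I_b,
                 [set: gs_vertex (distribution_graph phiC)] #= `I_(a + n * b)
               & [set: gs_edge (distribution_graph phiC)] #= `I_(n * k * b)]]).
Proof.
move=> X Xx Lk [_ Kc] _ _ + _ [[_ K'c] bijP _] wK' xE compL; subst x.
case: n => [//|n] _; rewrite [n.+1.-1]/=.
have cs : cone_structure X (row w P) (star_height K' P w) Lk.
  exact: realization_cone K'c bijP wK'.
have ls : link_pieces Lk L := components_pieces (link_compact K'c) compL.
have closedX : closed X.
  by apply: compact_closed; [exact: norm_hausdorff|exact: realization_compact].
have Lconn j : connected [set: L j].
  have [LC _ _] := compL; have [p _ <-] := LC j I.
  exact/connected_set_type/component_connected.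
have Lne j : [set: L j] !=set0.
  have [LC _ _] := compL; have [p Lp jE] := LC j I.
  have pj : p \in L j by rewrite -jE; apply/mem_set; exact: connected_component_refl.
  by exists (SigSub pj).
have prodE j : pi0 (conf n Xx * L j)%type = [set C `*` [set: L j] | C in pi0 (conf n Xx)].
  exact: (pi0_prod _ (Lconn j) (Lne j)).
have finA : finite_set (pi0 (conf n.+1 Xx)) := @finite_pi0_conf R d K (row w P) n.+1.
have finB : finite_set (pi0 (conf n Xx)) := @finite_pi0_conf R d K (row w P) n.
have finBL j : finite_set (pi0 (conf n Xx * L j)%type).
  by rewrite prodE; exact: finite_image.
split; first by move=> e e01; exact: (conf_outside_equivalence (m := n) cs closedX e01).
split; first exact: prodE.
move=> e r e01 [cincl cr _ inclr].
(* [phi] inserts a point at the fixed height [3e/4], while all points of [rho c] lie outside the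
   closed star and are therefore higher. *)
pose rho (c : conf n Xx) : conf n Xx := conf_outside_incl n X Lk (row w P) e (r c).
have rho_gt c l : e * (3 / 4) < star_height K' P w (row l (val (rho c))).
  apply: (outside_star_gt34 cs e01).
  by have [Yc _] := set_valP (r c); exact: Yc.
have tau01 : 0 < e * (3 / 4) <= 1 by case/andP: e01 => e0 e1; apply/andP; split; lra.
have phiP (i : 'I_n.+1) j (y : conf n Xx * L j) :
    @insert_point R n.+1 d i (cone_point (row w P) e (val y.2) (3 / 4))
      (val (r y.1)) \in conf n.+1 Xx.
  apply/mem_set; rewrite cone_pointE.
  apply: (@conf_near_Xx _ _ _ _ _ _ cs n i (rho y.1)) => //.
  exact: (piece_sub ls (set_valP y.2)).
pose phi i j (y : conf n Xx * L j) : conf n.+1 Xx := SigSub (phiP i j y).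
have phiC i j : continuous (phi i j).
  apply: cts_sub => /=; apply: cts_insert; last first.
    by apply: cts_val; apply: (cts_comp cr); cts.
  apply: (@cts_eq _ _ (fun y : conf n Xx * L j =>
    homothety (row w P) (e * (3 / 4)) (val y.2))) => [y|].
    by rewrite cone_pointE.
  by apply: cts_homothety; cts.
exists phi, phiC; split=> //.
- apply: homotopy_equivalent_sym.
  have crho : continuous rho by exact: (cts_comp cincl cr).
  have phi_phi1 i j : homotopic R (phi i j) (phi1 cs ls i (j := j)).
    apply: (homotopic_phi1 cs ls crho inclr tau01 rho_gt) => y.
    by rewrite /= cone_pointE.
  have phi1C i j : continuous (phi1 (n := n) cs ls i (j := j)).
    exact: phi1_continuous.
  have cyl := distribution_graph_cylinder (R := R) phiC finA finB finBL.
  have cyl1 := distribution_graph_cylinder (R := R) phi1C finA finB finBL.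
  apply: (homotopy_equivalent_trans _ (double_cylinder_conf cyl1)).
  exact: (cyl_homotopy_invariance cyl cyl1 phi_phi1).
- have [a cA] := finA; have [b cB] := finB.
  exists a, b; split.
  + by rewrite (card_eql (card_setT _)).
  + by rewrite (card_eql (card_setT _)).
  + exact: card_vertices.
  + apply: (@card_edges n.+1 k b (fun j => set (conf n Xx * L j))
      (fun j => pi0 (conf n Xx * L j)%type)) => j.
    (* Since [L j] is nonempty, [C] can be read off from its product with [L j]. *)
    rewrite prodE; apply: card_eq_trans cB; apply: inj_card_eq => C D _ _ CD.
    have [p _] := Lne j; apply/seteqP; split => c Sc.
      by have [] : (D `*` [set: L j]) (c, p) by rewrite -CD.
    by have [] : (C `*` [set: L j]) (c, p) by rewrite CD.
Qed.
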